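(* For all $s_1,s_2>0$, $$\psi(s_1,s_2)F(s_1,s_2)=\psi_1(s_1,s_2)\left[F_1(s_1)-F_1(q_2/r_2)\right]+\psi_2(s_1,s_2)\left[F_2(s_2)-F_2(q_1/r_1)\right]+F_0,$$ where $$\psi_1(s_1,s_2)=c_2-\frac{\lambda_2q_2}{(q_2+s_2)(q_2-r_2s_1)},\qquad \psi_2(s_1,s_2)=c_1-\frac{\lambda_1q_1}{(q_1+s_1)(q_1-r_1s_2)},$$ $$F_0=c_2F_1(q_2/r_2)+c_1F_2(q_1/r_1).$$ (At $s_1=q_2/r_2$ or $s_2=q_1/r_1$ the products on the right-hand side are understood by continuity.)
   Context: Let $c_i,\lambda_i,q_i,r_i>0$, $i=1,2$. $X_1,X_2$ are independent processes, $X_i(t)=c_it-\sum_{k=1}^{N_i(t)}\xi^{(i)}_k$, where $N_i$ is a Poisson process of rate $\lambda_i$ and the $\xi_k^{(i)}$ are i.i.d. exponential with rate $q_i$, all independent. The Laplace exponent $\psi(s_1,s_2)=\log\mathbb{E}e^{s_1X_1(1)+s_2X_2(1)}$ is $$\psi(s_1,s_2)=c_1s_1+c_2s_2-\lambda_1-\lambda_2+\frac{\lambda_1}{1+s_1/q_1}+\frac{\lambda_2}{1+s_2/q_2}.$$ With $\mu_i=c_i-\lambda_i/q_i$ it is assumed that $\mu_1<0$, $\mu_2<0$, $r_1|\mu_1|>|\mu_2|$ and $r_2|\mu_2|>|\mu_1|$. The reflected process $Y=(Y_1,Y_2)$ started at $(u,v)\in[0,\infty)^2$ moves linearly with velocity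 $(c_1,c_2)$ between the jumps of $X$; if $X_i$ jumps at time $T$ and $x_i=Y_i(T-)+\Delta X_i(T)$, then $Y_i(T)=x_i$, $Y_j(T)=Y_j(T-)$ if $x_i\ge0$, while $Y_i(T)=0$, $Y_j(T)=Y_j(T-)+r_i|x_i|$ if $x_i<0$ ($j\ne i$). Let $$p_1(u,v)=\mathbb{P}_{(u,v)}\{Y_1(t)\to\infty,\ Y_2(t)/Y_1(t)\to0\text{ as }t\to\infty\},$$ and for $s_1,s_2>0$ $$F(s_1,s_2)=\int_0^\infty\!\!\int_0^\infty e^{-s_1u-s_2v}p_1(u,v)\,du\,dv,\quad F_1(s_1)=\int_0^\infty e^{-s_1u}p_1(u,0)\,du,\quad F_2(s_2)=\int_0^\infty e^{-s_2v}p_1(0,v)\,dv.$$ *)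

(* Defs.v *)
From HB Require Import structures.
From mathcomp Require Import all_boot all_order all_algebra.
From mathcomp Require Import all_classical all_reals all_analysis.
Set Implicit Arguments.
Unset Strict Implicit.
Unset Printing Implicit Defensive.
Import Order.TTheory GRing.Theory Num.Theory.
Import numFieldNormedType.Exports.
Local Open Scope classical_set_scope.
Local Open Scope ring_scope.

Section Probability.
Context {R : realType} {d : measure_display} {T : measurableType d}.
Variable P : probability T R.

Definition exponential_rv (rate : R) (X : {RV P >-> R}) : Prop :=
  forall B : set R, measurable B -> P (X @^-1` B) = exponential_prob rate B.

Definition mutually_independent (I : eqType) (X : I -> {RV P >-> R}) : Prop :=
  forall (J : seq I) (B : I -> set R), uniq J ->
    (forall i, i \in J -> measurable (B i)) ->
    P (\bigcap_(i in [set` J]) (X i @^-1` B i)) =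
    (\prod_(i <- J) P (X i @^-1` B i))%E.

(* Joint family of four sequences, so that a single independence statement
   covers all of them. *)
Definition four_sequences (A B C D : nat -> {RV P >-> R}) (k : 'I_4 * nat)
  : {RV P >-> R} :=
  nth A [:: A; B; C; D] k.1 k.2.

End Probability.

Section Paths.
Context {R : realType}.

(* Epoch of the n-th event (epoch 0 is 0) when [tau k] is the k-th waiting
   time. *)
Definition epoch (tau : nat -> R) (n : nat) : R := \sum_(k < n) tau k.

(* Number of events in [0, t], i.e. the n with
   epoch tau n <= t < epoch tau n.+1.  If the [tau k] are i.i.d. exponential of
   rate lambda, this is the Poisson process of rate lambda.  The default value
   0 only concerns exploding sequences, which have probability 0. *)
Definition event_count (tau : nat -> R) (t : R) : nat :=
  match pselect (exists n, [pred n | t < epoch tau n.+1] n) with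
  | left h => ex_minn h
  | right _ => 0%N
  end.

(* The component that jumps goes to [x] if this is nonnegative, and otherwise
   to 0 while [r * |x|] is transferred to the other component [y].  Result:
   (jumping component, other component). *)
Definition reflect_jump (r x y : R) : R * R :=
  if 0 <= x then (x, y) else (0, y + r * `|x|).

Variables c1 c2 r1 r2 : R.
(* One sample of the driving data: waiting times and (downward) jump sizes of
   the two components, X_i(t) = c_i t - \sum_(k < event_count tau_i t) xi_i k. *)
Variables tau1 tau2 xi1 xi2 : nat -> R.

(* State at a jump epoch: numbers of jumps of X_1 and X_2 so far, the epoch,
   and the two components of Y at that epoch. *)
Record state := State
  { jumps1 : nat; jumps2 : nat; time : R; pos1 : R; pos2 : R }.

(* Linear motion up to the next jump of X, then that jump.  [z1], [z2] are the
   left limits Y_1(S-), Y_2(S-) at the next jump epoch S; simultaneous jumps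
   have probability 0. *)
Definition next_state (w : state) : state :=
  let S1 := epoch tau1 (jumps1 w).+1 in
  let S2 := epoch tau2 (jumps2 w).+1 in
  let S := Num.min S1 S2 in
  let z1 := pos1 w + c1 * (S - time w) in
  let z2 := pos2 w + c2 * (S - time w) in
  if S1 <= S2 then
    let y := reflect_jump r1 (z1 - xi1 (jumps1 w)) z2 in
    State (jumps1 w).+1 (jumps2 w) S y.1 y.2
  else
    let y := reflect_jump r2 (z2 - xi2 (jumps2 w)) z1 in
    State (jumps1 w) (jumps2 w).+1 S y.2 y.1.

Definition reflected (u v t : R) : R * R :=
  let w := iter (event_count tau1 t + event_count tau2 t) next_state
             (State 0 0 0 u v) in
  (pos1 w + c1 * (t - time w), pos2 w + c2 * (t - time w)).

End Paths.

(* The probability that Y_1 -> oo and Y_2 / Y_1 -> 0 when Y starts at (u, v). *)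
Definition escape1 {R : realType} {d : measure_display} {T : measurableType d}
    (P : probability T R) (c1 c2 r1 r2 : R)
    (tau1 tau2 xi1 xi2 : nat -> {RV P >-> R}) (u v : R) : R :=
  let Y (w : T) (t : R) :=
    reflected c1 c2 r1 r2 (tau1 ^~ w) (tau2 ^~ w) (xi1 ^~ w) (xi2 ^~ w) u v t in
  fine (P [set w | (Y w t).1 @[t --> +oo] --> +oo /\
                   ((Y w t).2 / (Y w t).1) @[t --> +oo] --> (0 : R)]).

Section Transforms.
Context {R : realType}.

Definition laplace (f : R -> R) (s : R) : R :=
  \int[lebesgue_measure]_(x in `[0, +oo[) (expR (- (s * x)) * f x).

Definition laplace2 (f : R -> R -> R) (s1 s2 : R) : R :=
  \int[lebesgue_measure]_(v in `[0, +oo[)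
    \int[lebesgue_measure]_(u in `[0, +oo[)
      (expR (- (s1 * u) - s2 * v) * f u v).

(* [f x], except that the value at [a] is understood by continuity. *)
Definition by_continuity (a : R) (f : R -> R) (x : R) : R :=
  if x == a then lim (f y @[y --> a^']) else f x.

Definition laplace_exponent (c1 c2 lam1 lam2 q1 q2 s1 s2 : R) : R :=
  c1 * s1 + c2 * s2 - lam1 - lam2
  + lam1 / (1 + s1 / q1) + lam2 / (1 + s2 / q2).

Definition kernel1 (c2 lam2 q2 r2 s1 s2 : R) : R :=
  c2 - lam2 * q2 / ((q2 + s2) * (q2 - r2 * s1)).

Definition kernel2 (c1 lam1 q1 r1 s1 s2 : R) : R :=
  c1 - lam1 * q1 / ((q1 + s1) * (q1 - r1 * s2)).

Definition drift (c lam q : R) : R := c - lam / q.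

End Transforms.

(* Main.v *)
Require Import Defs.
From HB Require Import structures.
From mathcomp Require Import all_boot all_order all_algebra.
From mathcomp Require Import all_classical all_reals all_analysis.
From mathcomp Require Import measurable_realfun ring lra.
Set Implicit Arguments.
Unset Strict Implicit.
Unset Printing Implicit Defensive.
Import Order.TTheory GRing.Theory Num.Theory.
Import numFieldNormedType.Exports.
Local Open Scope classical_set_scope.
Local Open Scope ring_scope.

(** Condition on the first jump of [X]. Up to that time [Y] moves linearly, and
    from then on it is a reflected process of the same kind started at the
    position after the jump, so the escape probability [p] satisfies
      [p (u, v) = E (p (position after the first jump))].
    The equation of the theorem is the double Laplace transform of this relation.

    The first-jump relation ([escape_first_jump]). The driving data form an array
    with four rows of i.i.d. exponential entries: the waiting times and the jump
    sizes of the two components. The restart is an identity between paths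
    ([reflected_jump1], [reflected_jump2]), in which the component that jumps
    loses the leading entries of its two rows and the waiting time of the other
    one is reduced by the elapsed time. Removing an independent leading entry
    does not change the law of the array ([integral_prepend]), and neither does
    reducing a waiting time, by the lack of memory
    ([integral_exponential_memoryless]). Two facts complete this part. The escape
    event is measurable, because the path is linear to the right of each time, so
    that rational times decide it ([measurable_escapes]). Explosion has
    probability 0, because the mean of [exp (- epoch n)] decays geometrically
    ([bounded_epochs_null]).

    Its transform. The linear motion contributes the drift part of the Laplace
    exponent and the boundary transforms [c2 F1(s1)] and [c1 F2(s2)]
    ([walk_balance]); this is integration by parts along the velocity, done here
    by Tonelli and a pointwise identity between weights, since [p] is only known
    to be measurable and bounded. A jump of the first component multiplies [F] by
    [q1 / (q1 + s1)] if it stays above 0; otherwise the undershoot is again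
    exponential of rate [q1], and the mean [S] of [p (0, y + r1 xi)] over it enters
    through its Laplace transform ([jump_mean_transform]). That transform is
      [(q1 - r1 s) L S (s) = q1 (F2 (s) - F2 (q1 / r1))]   ([spill_laplace]),
    which produces the kernel [psi2] and shows that its pole at [q1 / r1] is
    cancelled: near this point the product is a combination of two Laplace
    transforms of bounded functions, hence continuous ([removable_pole]). The
    second component is symmetric. Collecting the terms gives the equation
    ([kernel_equation]). *)

(** * Integrals over the half-line *)

(** The image of a measure, with the measurability of the map kept as an
    argument: it cannot be inferred from the map. *)
Definition image_measure {d d'} {T1 : measurableType d} {T2 : measurableType d'}
    {R : realType} (m : {measure set T1 -> \bar R}) (f : T1 -> T2)
    (mf : measurable_fun setT f) : {measure set T2 -> \bar R} :=
  measure_function_pushforward__canonical__measure_function_Measure m mf.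

Section affine.
Context {R : realType}.
Local Notation leb := (@lebesgue_measure R).
Local Open Scope ereal_scope.

Definition affine_map (a b : R) (x : measurableTypeR R) : measurableTypeR R :=
  (a * x + b)%R.

Lemma measurable_affine_map (a b : R) : measurable_fun setT (affine_map a b).
Proof. by apply: measurable_funD => //; exact: mulrl_measurable. Qed.

Lemma lebesgue_affine (a b : R) (a0 : (0 < a)%R) (A : set R) : measurable A ->
  leb A = mscale (NngNum (ltW a0)) (image_measure leb (measurable_affine_map a b)) A.
Proof.
apply: lebesgue_measure_unique => //= _ [[x y] /= _ <-].
rewrite /mscale/= /pushforward.
have -> : affine_map a b @^-1` `]x, y] = `]((x - b) / a)%R, ((y - b) / a)%R]%classic.
  apply/seteqP; split => z /=; rewrite !in_itv/= /affine_map ltr_pdivrMr// ler_pdivlMr//;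
   by rewrite ltrBlDr lerBrDr mulrC.
rewrite !lebesgue_measure_itv/= !lte_fin ltr_pM2r ?invr_gt0// ltrD2r.
case: ifPn => _; last by rewrite mule0.
by rewrite -!EFinD -EFinM; congr EFin; field; rewrite gt_eqF.
Qed.

Lemma integral_affine (a b : R) (f : R -> \bar R) : (0 < a)%R ->
  measurable_fun setT f -> (forall x, 0 <= f x) ->
  a%:E * \int[leb]_x f (a * x + b)%R = \int[leb]_x f x.
Proof.
move=> a0 mf f0.
have := @ge0_integral_pushforward _ _ _ _ _ _ (measurable_affine_map a b) leb setT f
  measurableT mf (fun x _ => f0 x).
rewrite preimage_setT => <-.
have f0' x : [set: measurableTypeR R] x -> 0 <= f x by [].
have := @ge0_integral_mscale _ _ _ (image_measure leb (measurable_affine_map a b)) setT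
  measurableT (NngNum (ltW a0)) f mf f0'.
move=> /= <-.
apply: eq_measure_integral => //= A mA _.
by rewrite [RHS](@lebesgue_affine a b a0).
Qed.
End affine.

Reserved Notation "\intp_ x F" (at level 36, F at level 36, x at level 0,
  right associativity, format "'[' \intp_ x '/  '  F ']'").
Notation "\intp_ x F" :=
  (\int[lebesgue_measure]_(x in `[0%R, +oo[%classic) F%E)%E : ereal_scope.

Definition eind {R : realType} (b : bool) : \bar R := (b%:R)%:E.

Section measurability.
Context d (X : measurableType d) (R : realType).
Implicit Type b : X -> bool.

Lemma measurable_eind b :
  measurable_fun setT b -> measurable_fun setT (fun x => eind (b x) : \bar R).
Proof.
move=> mb; rewrite /eind; apply/measurable_EFinP.
exact: (@measurableT_comp _ _ _ _ _ _ (fun b : bool => b%:R : R)).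
Qed.

Lemma measurable_comp2 d1 d2 d3 (A : measurableType d1) (B : measurableType d2)
  (C : measurableType d3) (p : A -> B -> C) (f : X -> A) (g : X -> B) :
  measurable_fun setT (fun w : A * B => p w.1 w.2) ->
  measurable_fun setT f -> measurable_fun setT g ->
  measurable_fun setT (fun x => p (f x) (g x)).
Proof.
move=> mp mf mg.
exact: (measurableT_comp mp (measurable_fun_pair mf mg)).
Qed.

Lemma measurable_int_param d' (Y : measurableType d')
  (m : {sigma_finite_measure set Y -> \bar R})
  (F : X -> Y -> \bar R) :
  (forall x y, (0 <= F x y)%E) ->
  measurable_fun setT (fun w : X * Y => F w.1 w.2) ->
  measurable_fun setT (fun x => (\int[m]_y F x y)%E).
Proof.
move=> F0 mF.
exact: (@measurable_fun_fubini_tonelli_F _ _ _ _ _ m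
  (fun w : X * Y => F w.1 w.2)).
Qed.
End measurability.

Lemma measurable_pr1 {d1 d2} {A : measurableType d1} {B : measurableType d2}
  {d} {X : measurableType d} (f : X -> A * B) :
  measurable_fun setT f -> measurable_fun setT (fun x => (f x).1).
Proof. by move=> mf; exact: (measurableT_comp measurable_fst mf). Qed.

Lemma measurable_pr2 {d1 d2} {A : measurableType d1} {B : measurableType d2}
  {d} {X : measurableType d} (f : X -> A * B) :
  measurable_fun setT f -> measurable_fun setT (fun x => (f x).2).
Proof. by move=> mf; exact: (measurableT_comp measurable_snd mf). Qed.

Section halfline.
Context {R : realType}.
Local Notation leb := (@lebesgue_measure R).
Local Open Scope ereal_scope.
Implicit Types f g : R -> \bar R.

Lemma eind_ge0 (b : bool) : (0 : \bar R) <= eind b.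
Proof. by rewrite lee_fin. Qed.

Lemma eindT : eind true = 1 :> \bar R. Proof. by []. Qed.
Lemma eindF : eind false = 0 :> \bar R. Proof. by []. Qed.

Lemma eq_intp f g : (forall x, (0 <= x)%R -> f x = g x) ->
  \intp_x f x = \intp_x g x.
Proof.
move=> fg; apply: eq_integral => x; rewrite inE/= in_itv/= andbT; exact: fg.
Qed.

Lemma intpE f : \intp_x f x = \int[leb]_x (eind (0 <= x)%R * f x).
Proof.
rewrite integral_mkcond; apply: eq_integral => x _.
rewrite patchE mem_setE in_itv/= andbT.
by case: ifPn => _; rewrite ?eindT ?eindF ?mul1e ?mul0e.
Qed.

Lemma intp_ge0 f : (forall x, (0 <= x)%R -> 0 <= f x) -> 0 <= \intp_x f x.
Proof. by move=> f0; apply: integral_ge0 => x /=; rewrite in_itv/= andbT; exact: f0. Qed.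

Lemma intp_shift f (h : R) : (0 <= h)%R ->
  measurable_fun setT f -> (forall x, 0 <= f x) ->
  \intp_x f (x + h)%R = \intp_x (eind (h <= x)%R * f x).
Proof.
move=> h0 mf f0; rewrite !intpE.
have mi (a : R) : measurable_fun setT (fun x : R => eind (a <= x)%R : \bar R).
  exact/measurable_eind/measurable_fun_ler.
rewrite -(@integral_affine _ 1 h
  (fun x => eind (0 <= x)%R * (eind (h <= x)%R * f x)))// ?mul1e.
- apply: eq_integral => x _; rewrite mul1r lerDr.
  by rewrite /eind; case: leP => x0; rewrite ?mul0e ?mule0// (addr_ge0 x0 h0) !mul1e.
- by apply: emeasurable_funM => //; exact: emeasurable_funM.
- by move=> x; rewrite !mule_ge0 ?eind_ge0.
Qed.

Lemma intp_scale f (c : R) : (0 < c)%R ->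
  measurable_fun setT f -> (forall x, 0 <= f x) ->
  c%:E * \intp_x f (c * x)%R = \intp_x f x.
Proof.
move=> c0 mf f0; rewrite !intpE.
rewrite -(@integral_affine _ c 0 (fun x => eind (0 <= x)%R * f x))//.
- by congr (_ * _); apply: eq_integral => x _; rewrite addr0 pmulr_rge0.
- by apply: emeasurable_funM => //; exact/measurable_eind/measurable_fun_ler.
- by move=> x; rewrite mule_ge0// eind_ge0.
Qed.

Lemma measurable_intp d (X : measurableType d) (F : X -> R -> \bar R) :
  (forall x y, 0 <= F x y) ->
  measurable_fun setT (fun w : X * R => F w.1 w.2) ->
  measurable_fun setT (fun x => \intp_y F x y).
Proof.
move=> F0 mF; rewrite (_ : (fun x => _) = fun x =>
    \int[leb]_y (eind (0 <= y)%R * F x y)); last first.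
  by apply/funext => x; rewrite intpE.
apply: measurable_int_param => [x y|]; first by rewrite mule_ge0// eind_ge0.
apply: emeasurable_funM => //.
exact/measurable_eind/measurable_fun_ler.
Qed.

Lemma intp_swap (F : R -> R -> \bar R) :
  (forall x y, 0 <= F x y) ->
  measurable_fun setT (fun w : R * R => F w.1 w.2) ->
  \intp_x \intp_y F x y = \intp_y \intp_x F x y.
Proof.
move=> F0 mF.
have mi (a : R) : measurable_fun setT (fun x : R => eind (a <= x)%R : \bar R).
  exact/measurable_eind/measurable_fun_ler.
have mF1 x : measurable_fun setT (F x)
  by exact: (measurableT_comp mF (pair1_measurable x)).
have mF2 y : measurable_fun setT (F ^~ y)
  by exact: (measurableT_comp mF (pair2_measurable y)).
pose G (w : R * R) := eind (0 <= w.1)%R * (eind (0 <= w.2)%R * F w.1 w.2).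
have G0 w : 0 <= G w by rewrite !mule_ge0// eind_ge0.
have mG : measurable_fun setT G.
  apply: emeasurable_funM; last apply: emeasurable_funM => //.
  - exact/measurable_eind/measurable_fun_ler.
  - exact/measurable_eind/measurable_fun_ler.
transitivity (\int[leb]_x \int[leb]_y G (x, y)).
  rewrite intpE; apply: eq_integral => x _; rewrite intpE -ge0_integralZl//.
  - by apply: emeasurable_funM; [exact: mi|exact: mF1].
  - by move=> y _; rewrite mule_ge0// eind_ge0.
  - exact: eind_ge0.
rewrite fubini_tonelli//.
rewrite intpE; apply: eq_integral => y _; rewrite intpE -ge0_integralZl//.
- by apply: eq_integral => x _; rewrite /G/= muleCA.
- by apply: emeasurable_funM; [exact: mi|exact: mF2].
- by move=> x _; rewrite mule_ge0// eind_ge0.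
- exact: eind_ge0.
Qed.

Lemma intpZl f (k : \bar R) : 0 <= k -> measurable_fun setT f -> (forall x, 0 <= f x) ->
  \intp_x (k * f x) = k * \intp_x f x.
Proof.
by move=> k0 mf f0; rewrite ge0_integralZl//; exact: measurable_funTS.
Qed.

Lemma intpZr f (k : \bar R) : 0 <= k -> measurable_fun setT f -> (forall x, 0 <= f x) ->
  \intp_x (f x * k) = (\intp_x f x) * k.
Proof.
by move=> k0 mf f0; rewrite ge0_integralZr//; exact: measurable_funTS.
Qed.

Lemma intpD f g : measurable_fun setT f -> (forall x, 0 <= f x) ->
  measurable_fun setT g -> (forall x, 0 <= g x) ->
  \intp_x (f x + g x) = \intp_x f x + \intp_x g x.
Proof.
by move=> mf f0 mg g0; rewrite ge0_integralD//; exact: measurable_funTS.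
Qed.

(** Points are null for Lebesgue measure. *)
Lemma eq_intp_but f g (a : R) : measurable_fun setT f -> measurable_fun setT g ->
  (forall x, (0 <= x)%R -> x != a -> f x = g x) ->
  \intp_x f x = \intp_x g x.
Proof.
move=> mf mg fg; rewrite -(@integral_setD1 _ f a)//; last 2 first.
- exact: measurableD.
- exact: measurable_funTS.
rewrite -[RHS](@integral_setD1 _ g a)//; last 2 first.
- exact: measurableD.
- exact: measurable_funTS.
apply: eq_integral => x; rewrite inE/= in_itv/= andbT => -[x0 /eqP xa].
exact: fg.
Qed.
End halfline.

(** Nonnegativity of an explicit formula, by recursion on it. *)
Ltac nneg :=
  intros; cbv beta; repeat first
  [ assumption
  | match goal with
    | |- is_true (Order.le _ (eind _)) => exact: eind_ge0
    | |- is_true (Order.le _ (expR _)) => exact: expR_ge0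
    | |- is_true (Order.le _ (mule _ _)) => apply: mule_ge0
    | |- is_true (Order.le _ (integral _ _ _)) => apply: intp_ge0; intros
    | |- is_true (Order.le _ (EFin _)) => rewrite lee_fin
    | |- is_true (Order.le _ (GRing.add _ _)) => apply: adde_ge0
    | |- is_true (Order.le _ (GRing.add _ _)) => apply: addr_ge0
    | |- is_true (Order.le _ (GRing.mul _ _)) => apply: mulr_ge0
    end
  | exact: ltW
  | done
  | exact: expR_ge0 ].

(** Measurability of an explicit formula, by recursion on it. *)
Ltac meas := cbv beta;
  repeat first
  [ match goal with
    | |- measurable_fun _ (fun x => x) => exact: measurable_id
    | |- measurable_fun _ (fun x => ?c) => exact: measurable_cst
    | |- measurable_fun _ (fun x => fst x) => exact: measurable_fst
    | |- measurable_fun _ (fun x => snd x) => exact: measurable_snd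
    | |- measurable_fun _ (fun x => GRing.add (@?f x) (@?g x)) =>
        apply: (measurable_funD (f := f) (g := g))
    | |- measurable_fun _ (fun x => GRing.mul (@?f x) (@?g x)) =>
        apply: (measurable_funM (f := f) (g := g))
    | |- measurable_fun _ (fun x => GRing.opp (@?f x)) =>
        apply: (measurable_funN (f := f))
    | |- measurable_fun _ (fun x => expR (@?f x)) =>
        apply: (measurableT_comp (f := expR) (g := f)) => //
    | |- measurable_fun _ (fun x => EFin (@?f x)) =>
        apply/measurable_EFinP
    | |- measurable_fun _ (fun x => GRing.add (@?f x) (@?g x)) =>
        apply: (emeasurable_funD (f := f) (g := g))
    | |- measurable_fun _ (fun x => mule (@?f x) (@?g x)) =>
        apply: (emeasurable_funM (f := f) (g := g))
    | |- measurable_fun _ (fun x => eind (@?f x)) =>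
        apply: (measurable_eind (b := f))
    | |- measurable_fun _ (fun x => Order.le (@?f x) (@?g x)) =>
        apply: (measurable_fun_ler (f := f) (g := g))
    | |- measurable_fun _ (fun x => Order.lt (@?f x) (@?g x)) =>
        apply: (measurable_fun_ltr (f := f) (g := g))
    | |- measurable_fun _ (fun x => fst (@?f x)) =>
        apply: (measurable_pr1 (f := f))
    | |- measurable_fun _ (fun x => snd (@?f x)) =>
        apply: (measurable_pr2 (f := f))
    | |- measurable_fun _ (fun x => pair (@?f x) (@?g x)) =>
        apply: (measurable_fun_pair (f := f) (g := g))
    | |- measurable_fun _ (fun x => integral lebesgue_measure _ (@?F x)) =>
        apply: (measurable_intp (F := F)); [by nneg | cbv beta]
    end
  | match goal with
    | H : measurable_fun _ (fun w => ?p (fst w) (snd w)) |-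
        measurable_fun _ (fun x => ?p (@?f x) (@?h x)) =>
        apply: (measurable_comp2 (f := f) (g := h) H)
    | H : measurable_fun _ ?p |- measurable_fun _ (fun x => ?p (@?f x)) =>
        apply: (measurableT_comp (f := p) (g := f) H)
    end
  | assumption ].

Section double_integrals.
Context {R : realType}.
Local Open Scope ereal_scope.
Implicit Types f g : R -> R -> \bar R.

Lemma intp2D f g :
  measurable_fun setT (fun w : R * R => f w.1 w.2) -> (forall x y, 0 <= f x y) ->
  measurable_fun setT (fun w : R * R => g w.1 w.2) -> (forall x y, 0 <= g x y) ->
  \intp_y \intp_x (f x y + g x y) =
  \intp_y \intp_x f x y + \intp_y \intp_x g x y.
Proof.
move=> mf f0 mg g0; rewrite -intpD; last first.
- by nneg.
- by meas.
- by nneg.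
- by meas.
apply: eq_intp => y _; rewrite intpD //; by meas.
Qed.

Lemma intp2Zl f (k : \bar R) : 0 <= k ->
  measurable_fun setT (fun w : R * R => f w.1 w.2) -> (forall x y, 0 <= f x y) ->
  \intp_y \intp_x (k * f x y) = k * \intp_y \intp_x f x y.
Proof.
move=> k0 mf f0; rewrite -intpZl//; last first.
- by nneg.
- by meas.
by apply: eq_intp => y _; rewrite intpZl//; meas.
Qed.

End double_integrals.

(** * Exponentials on the half-line *)

Section exponentials.
Context {R : realType}.
Local Notation leb := (@lebesgue_measure R).
Local Open Scope ereal_scope.

Lemma continuous_expRN (k : R) : continuous (fun x : R => expR (- (k * x)))%R.
Proof.
move=> x; apply: continuous_comp; last exact: continuous_expR.
by apply: continuousN; apply: mulrl_continuous.
Qed.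

Lemma continuous_MexpRN (c k : R) :
  continuous (fun x : R => c * expR (- (k * x)))%R.
Proof.
move=> x; apply: (@continuousM _ R^o (fun=> c) (fun x => expR (- (k * x)))%R).
  exact: cst_continuous.
exact: continuous_expRN.
Qed.

Lemma intp_expR (r : R) : (0 < r)%R -> \intp_x (r * expR (- (r * x)))%:E = 1.
Proof.
move=> r0; rewrite -(integral_exponential_pdf r0) integral_mkcond.
apply: eq_integral => x _; rewrite /exponential_pdf !patchE.
by case: ifPn => //; rewrite mulNr.
Qed.

Lemma intp_trunc (f : R -> \bar R) (m : R) :
  \intp_x (eind (x <= m)%R * f x) = \int[leb]_(x in `[0%R, m]) f x.
Proof.
rewrite intpE [RHS]integral_mkcond; apply: eq_integral => x _.
rewrite patchE mem_setE in_itv/= /eind.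
by case: (0 <= x)%R; case: (x <= m)%R; rewrite ?mul0e ?mule0 ?mul1e.
Qed.

Lemma is_derive_expRN (k x : R) :
  is_derive x 1%R (fun y : R => - expR (- (k * y)))%R (k * expR (- (k * x)))%R.
Proof.
apply: is_derive_eq.
by rewrite /GRing.scale/=; ring.
Qed.

(** The rates met below have either sign and may vanish, so the integral is
    given by its product with [k] rather than by a quotient; this form needs no
    case distinction. *)
Lemma intp_expR_trunc (k m : R) : (0 <= m)%R ->
  let J := \intp_x (eind (x <= m)%R * (expR (- (k * x)))%:E) in
  J \is a fin_num /\ k%:E * J = (1 - expR (- (k * m)))%:E.
Proof.
rewrite le_eqVlt => /predU1P[<-|m0]; rewrite /= intp_trunc.
  by rewrite set_itv1 integral_set1 mule0 mulr0 oppr0 expR0 subrr.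
have ie (c : R) : leb.-integrable `[0%R, m] (EFin \o (fun x => c * expR (- (k * x)))%R).
  apply: continuous_compact_integrable; first exact: segment_compact.
  by apply: continuous_subspaceT => x; exact: continuous_MexpRN.
have ie1 : leb.-integrable `[0%R, m] (EFin \o (fun x => expR (- (k * x)))%R).
  rewrite (_ : (fun x => _) = (fun x => 1 * expR (- (k * x)))%R); first exact: ie.
  by apply/funext => x; rewrite mul1r.
split; first exact: integrable_fin_num.
rewrite -integralZl//.
have -> : (1 - expR (- (k * m)))%:E =
  (- expR (- (k * m)))%:E - (- expR (- (k * 0)))%:E.
  by rewrite mulr0 oppr0 expR0 -EFinB opprK addrC.
under eq_integral do rewrite -EFinM.
apply: (@continuous_FTC2 _ _ (fun y => - expR (- (k * y)))%R) => //.
- by apply: continuous_subspaceT => x; exact: continuous_MexpRN.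
- split.
  + by move=> x _; have [] := is_derive_expRN k x.
  + by apply/cvg_at_right_filter; apply: cvgN; exact: continuous_expRN.
  + by apply/cvg_at_left_filter; apply: cvgN; exact: continuous_expRN.
- by move=> x _; rewrite derive1E; apply: derive_val; exact: is_derive_expRN.
Qed.
End exponentials.

(** * Transform of the free motion *)

Section walk_bottom.
Context {R : realType}.
Local Open Scope ereal_scope.

(** Tonelli, translation of [u] by [c1 * a], and the change of the time [a]
    into the height [y = c2 * a] reached from the bottom edge; the factor [c2]
    is the Jacobian of that change. The point [(x, y)] is reached when the
    starting abscissa [x - c1 * (y / c2)] is nonnegative. *)
Lemma walk_bottom (c1 c2 lam s1 s2 : R) (g : R -> R -> \bar R) :
  (0 < c1)%R -> (0 < c2)%R -> (forall x y, 0 <= g x y) ->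
  measurable_fun setT (fun w : R * R => g w.1 w.2) ->
  c2%:E * \intp_u ((expR (- (s1 * u)))%:E *
    \intp_a ((expR (- (lam * a)))%:E * g (u + c1 * a)%R (c2 * a)%R)) =
  \intp_y \intp_x (eind (c1 * (y / c2) <= x)%R *
    ((expR (- ((lam - s1 * c1 - s2 * c2) * (y / c2))))%:E *
     ((expR (- (s1 * x) - s2 * y))%:E * g x y))).
Proof.
move=> c1_gt0 c2_gt0 g0 mg.
pose k (a x y : R) := expR (- (s1 * (x - c1 * a)) - lam * a)%R.
pose f (a x y : R) := (k a x y)%:E * g x y.
pose h y := \intp_x (eind (c1 * (y / c2) <= x)%R * f (y / c2)%R x y).
rewrite (_ : \intp_u _ = \intp_a h (c2 * a)%R); last first.
  transitivity (\intp_u \intp_a f a (u + c1 * a)%R (c2 * a)%R).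
    apply: eq_intp => u _; rewrite -intpZl; last first.
    - by nneg.
    - by meas.
    - by nneg.
    apply: eq_intp => a _; rewrite muleA -EFinM -expRD /f /k.
    by congr ((expR _)%:E * _); ring.
  rewrite intp_swap; last 2 first.
  - by rewrite /f; nneg.
  - by rewrite /f /k; meas.
  apply: eq_intp => a a0.
  rewrite (@intp_shift _ (fun x => f a x (c2 * a)%R)); last first.
  - by rewrite /f; nneg.
  - by rewrite /f /k; meas.
  - by rewrite mulr_ge0// ltW.
  by apply: eq_intp => x _; rewrite mulrAC divff ?gt_eqF// mul1r.
rewrite (intp_scale c2_gt0); last first.
- by rewrite /h /f; nneg.
- by rewrite /h /f /k; meas.
apply: eq_intp => y _; apply: eq_intp => x _; congr (_ * _).
rewrite /f muleA -EFinM -expRD; congr ((expR _)%:E * _).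
by rewrite /k; field; rewrite gt_eqF.
Qed.

End walk_bottom.

Section walk.
Context {R : realType}.
Local Open Scope ereal_scope.
Variables (c1 c2 lam s1 s2 : R) (g : R -> R -> \bar R).
Hypotheses (c1_gt0 : (0 < c1)%R) (c2_gt0 : (0 < c2)%R).
Hypotheses (lam_ge0 : (0 <= lam)%R) (s1_ge0 : (0 <= s1)%R) (s2_ge0 : (0 <= s2)%R).
Hypothesis g0 : forall x y, 0 <= g x y.
Hypothesis mg : measurable_fun setT (fun w : R * R => g w.1 w.2).

(* [T u v] is the value at [(u, v)] of [g] taken along the motion killed at
   rate [lam]; [K x y] is the total weight with which the motions started in
   the quadrant contribute to its transform at [(x, y)]. *)
Let kappa : R := (lam - s1 * c1 - s2 * c2)%R.
Let T (u v : R) : \bar R :=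
  \intp_a ((expR (- (lam * a)))%:E * g (u + c1 * a)%R (v + c2 * a)%R).
Let e (x y : R) : R := expR (- (s1 * x) - s2 * y)%R.
Let H (x y : R) : \bar R := (e x y)%:E * g x y.
Let K (x y : R) : \bar R := \intp_a (eind (c1 * a <= x)%R *
  (eind (c2 * a <= y)%R * (expR (- (kappa * a)))%:E)).

(** Tonelli, and translation of the starting point by the displacement: the
    time [a] contributes at [(x, y)] when [(x - c1 * a, y - c2 * a)] is still in
    the quadrant. *)
Lemma walk_interior :
  \intp_v \intp_u ((e u v)%:E * T u v) = \intp_y \intp_x (K x y * H x y).
Proof.
pose k (a u v : R) := expR (- (s1 * u) - s2 * v - lam * a)%R.
transitivity (\intp_v \intp_u \intp_a ((k a u v)%:E * g (u + c1 * a)%R (v + c2 * a)%R)).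
  apply: eq_intp => v _; apply: eq_intp => u _; rewrite -intpZl; last first.
  - by nneg.
  - by meas.
  - by nneg.
  by apply: eq_intp => a _; rewrite muleA -EFinM -expRD.
transitivity (\intp_v \intp_a \intp_u ((k a u v)%:E * g (u + c1 * a)%R (v + c2 * a)%R)).
  apply: eq_intp => v _; apply: intp_swap; first by nneg.
  by rewrite /k; meas.
rewrite intp_swap; last 2 first.
- by nneg.
- by rewrite /k; meas.
pose f (a x y : R) := (expR (- (kappa * a)))%:E * H x y.
have f0 a x y : 0 <= f a x y by rewrite /f /H; nneg.
transitivity (\intp_a \intp_y \intp_x (eind (c1 * a <= x)%R * (eind (c2 * a <= y)%R * f a x y))).
  apply: eq_intp => a a0.
  have ca1 : (0 <= c1 * a)%R by rewrite mulr_ge0// ltW.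
  have ca2 : (0 <= c2 * a)%R by rewrite mulr_ge0// ltW.
  transitivity (\intp_v \intp_x (eind (c1 * a <= x)%R * f a x (v + c2 * a)%R)).
    apply: eq_intp => v _; rewrite -intp_shift//; last first.
      by rewrite /f /H /e; meas.
    apply: eq_intp => u _; rewrite /f /H muleA -EFinM; congr (_%:E * _).
    by rewrite /k /e -expRD /kappa; congr expR; ring.
  rewrite (@intp_shift _ (fun y => \intp_x (eind (c1 * a <= x)%R * f a x y)))//; last first.
  - by nneg.
  - by rewrite /f /H /e; meas.
  apply: eq_intp => y _; rewrite -intpZl; last first.
  - by nneg.
  - by rewrite /f /H /e; meas.
  - by nneg.
  by apply: eq_intp => x _; rewrite muleCA.
rewrite intp_swap; last 2 first.
- by nneg.
- by rewrite /f /H /e; meas.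
apply: eq_intp => y _; rewrite intp_swap; last 2 first.
- by nneg.
- by rewrite /f /H /e; meas.
apply: eq_intp => x _; rewrite -intpZr; last first.
- by nneg.
- by meas.
- by rewrite /H; nneg.
by apply: eq_intp => a _; rewrite /f !muleA.
Qed.

(** On the line of motion through [(x, y)], the point is reached from the edge
    of the quadrant after exactly the time [m] and from the interior after any
    time below [m]; hence the two boundary terms add up to [exp (- kappa * m)],
    and [K x y] is the integral of [exp (- kappa * a)] over [a <= m]. The strict
    and the large inequality attribute the points whose line leads to the corner
    to one of the two edges. *)
Let K_balance (x y : R) : (0 <= x)%R -> (0 <= y)%R ->
  lam%:E * K x y + eind (c1 * (y / c2) <= x)%R * (expR (- (kappa * (y / c2))))%:E
    + eind (c2 * (x / c1) < y)%R * (expR (- (kappa * (x / c1))))%:E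
  = 1 + (s1 * c1 + s2 * c2)%:E * K x y.
Proof.
move=> x0 y0.
pose m : R := Num.min (x / c1)%R (y / c2)%R.
have m0 : (0 <= m)%R by rewrite le_min !divr_ge0// ltW.
have KE : K x y = \intp_a (eind (a <= m)%R * (expR (- (kappa * a)))%:E).
  apply: eq_intp => a _; rewrite muleA; congr (_ * _).
  rewrite /eind -EFinM -natrM mulnb /m le_min !ler_pdivlMr//.
  by rewrite ![(_ * a)%R]mulrC.
have := intp_expR_trunc kappa m0; rewrite /= -KE => -[Kfin kK].
rewrite -addeA.
have -> : eind (c1 * (y / c2) <= x)%R * (expR (- (kappa * (y / c2))))%:E
    + eind (c2 * (x / c1) < y)%R * (expR (- (kappa * (x / c1))))%:E
  = (expR (- (kappa * m)))%:E.
  rewrite mulrC -ler_pdivlMr// [(c2 * _)%R]mulrC -ltr_pdivlMr// /m /eind.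
  by case: ltP => h; rewrite ?mul1e ?mul0e ?add0e ?adde0.
move: kK; rewrite -(fineK Kfin) -!EFinM -!EFinD => -[kK].
by congr _%:E; move: kK; rewrite {1}/kappa; lra.
Qed.

(** The generator identity [lam T - c . grad T = g], multiplied by
    [exp (- s1 u - s2 v)] and integrated by parts. As [T] may fail to be
    differentiable, Tonelli takes the place of the integration by parts: both
    sides become integrals of [e x y * g x y] against weights that agree by
    [K_balance]. *)
Lemma walk_balance :
  lam%:E * \intp_v \intp_u ((e u v)%:E * T u v)
  + c2%:E * \intp_u ((expR (- (s1 * u)))%:E * T u 0)
  + c1%:E * \intp_v ((expR (- (s2 * v)))%:E * T 0 v)
  = \intp_v \intp_u ((e u v)%:E * g u v)
  + (s1 * c1 + s2 * c2)%:E * \intp_v \intp_u ((e u v)%:E * T u v).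
Proof.
rewrite walk_interior.
have -> : c2%:E * \intp_u ((expR (- (s1 * u)))%:E * T u 0) =
    \intp_y \intp_x (eind (c1 * (y / c2) <= x)%R * (expR (- (kappa * (y / c2))))%:E * H x y).
  rewrite (_ : \intp_u _ = \intp_u ((expR (- (s1 * u)))%:E *
      \intp_a ((expR (- (lam * a)))%:E * g (u + c1 * a)%R (c2 * a)%R))).
    rewrite (walk_bottom lam s1 s2 c1_gt0 c2_gt0 g0 mg).
    by apply: eq_intp => y _; apply: eq_intp => x _; rewrite -muleA.
  apply: eq_intp => u _; congr (_ * _); apply: eq_intp => a _.
  by rewrite add0r.
have -> : c1%:E * \intp_v ((expR (- (s2 * v)))%:E * T 0 v) =
    \intp_y \intp_x (eind (c2 * (x / c1) < y)%R * (expR (- (kappa * (x / c1))))%:E * H x y).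
  rewrite (_ : \intp_v _ = \intp_v ((expR (- (s2 * v)))%:E *
      \intp_a ((expR (- (lam * a)))%:E * g (c1 * a)%R (v + c2 * a)%R))); last first.
    apply: eq_intp => u _; congr (_ * _); apply: eq_intp => a _.
    by rewrite add0r.
  have mg' : measurable_fun setT (fun w : R * R => g w.2 w.1) by meas.
  rewrite (walk_bottom lam s2 s1 c2_gt0 c1_gt0 (fun y x => g0 x y) mg').
  rewrite intp_swap; last 2 first.
  - by nneg.
  - by meas.
  apply: eq_intp => y _.
  apply: (@eq_intp_but _ _ _ (y / c2 * c1)%R).
  - by meas.
  - by rewrite /H /e; meas.
  move=> x _ xy; rewrite -muleA; congr (eind _ * _).
    rewrite lt_neqAle andb_idl// => _; apply: contra_neq xy => <-.
    by field; rewrite !gt_eqF.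
  rewrite /H /e; congr (_%:E * (_%:E * _)); first by congr expR; rewrite /kappa; ring.
  by congr expR; ring.
have mK : measurable_fun setT (fun w : R * R => K w.1 w.2) by rewrite /K; meas.
have K0 x y : 0 <= K x y by rewrite /K; nneg.
have H0 x y : 0 <= H x y by rewrite /H; nneg.
have mH : measurable_fun setT (fun w : R * R => H w.1 w.2) by rewrite /H /e; meas.
have sc0 : 0 <= (s1 * c1 + s2 * c2)%:E by nneg.
have mKH : measurable_fun setT (fun w : R * R => K w.1 w.2 * H w.1 w.2) by meas.
have KH0 x y : 0 <= K x y * H x y by nneg.
have lam0 : 0 <= lam%:E by rewrite lee_fin.
rewrite -(intp2Zl lam0 mKH KH0) -(intp2Zl sc0 mKH KH0).
rewrite -(intp2D (f := fun x y => lam%:E * (K x y * H x y))); last first.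
- by nneg.
- by meas.
- by nneg.
- by meas.
rewrite -(intp2D (f := fun x y => lam%:E * (K x y * H x y) + _)); last first.
- by nneg.
- by meas.
- by nneg.
- by meas.
rewrite -(intp2D (f := fun x y => (e x y)%:E * g x y)); last first.
- by nneg.
- by meas.
- by nneg.
- by rewrite /e; meas.
apply: eq_intp => y y0; apply: eq_intp => x x0.
rewrite muleA -!ge0_muleDl; [|by nneg..].
rewrite K_balance// ge0_muleDl; [|by nneg..].
by rewrite mul1e -muleA.
Qed.
End walk.

(** * Transform of a reflected jump *)

Section jump.
Context {R : realType}.
Local Open Scope ereal_scope.

Lemma intp_expR_scaled (c r : R) : (0 <= c)%R -> (0 < r)%R ->
  \intp_x (c * expR (- (r * x)))%:E = (c / r)%:E.
Proof.
move=> c0 r0; transitivity (\intp_x ((c / r)%:E * (r * expR (- (r * x)))%:E)).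
  by apply: eq_intp => x _; rewrite -EFinM mulrA divfK// gt_eqF.
rewrite intpZl ?intp_expR ?mule1//.
- by rewrite lee_fin divr_ge0// ltW.
- by meas.
- by nneg.
Qed.

(** Split at [z = x]. For [z <= x] the position [x - z] left after the jump is the
    new variable, and the two exponentials in [z] merge into one of rate [q + s];
    for [z > x] the overshoot [z - x] is again exponential of rate [q], which
    separates [chi] from [x]. *)
Lemma jump_transform1 (q s : R) (f chi : R -> \bar R) : (0 < q)%R -> (0 < s)%R ->
  (forall x, 0 <= f x) -> (forall x, 0 <= chi x) ->
  measurable_fun setT f -> measurable_fun setT chi ->
  \intp_x ((expR (- (s * x)))%:E * \intp_z ((q * expR (- (q * z)))%:E *
    (if (0 <= x - z)%R then f (x - z)%R else chi (z - x)%R))) =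
  (q / (q + s))%:E * \intp_x ((expR (- (s * x)))%:E * f x) +
  (1 / (q + s))%:E * \intp_w ((q * expR (- (q * w)))%:E * chi w).
Proof.
move=> q0 s0 f0 chi0 mf mchi.
have qs0 : (0 < q + s)%R by rewrite addr_gt0.
pose k (x z : R) : R := (q * expR (- (s * x) - q * z))%R.
have k0 x z : (0 <= k x z)%R by rewrite /k; nneg.
transitivity (\intp_x \intp_z ((k x z)%:E * (eind (z <= x)%R * f (x - z)%R)) +
              \intp_x \intp_z ((k x z)%:E * (eind (x < z)%R * chi (z - x)%R))).
  rewrite -intpD; last first.
  - by nneg.
  - by rewrite /k; meas.
  - by nneg.
  - by rewrite /k; meas.
  apply: eq_intp => x _; rewrite -intpD; last first.
  - by nneg.
  - by rewrite /k; meas.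
  - by nneg.
  - by rewrite /k; meas.
  rewrite -intpZl; last first.
  - by move=> z; case: ifPn => _; nneg.
  - apply: emeasurable_funM; first by meas.
    by apply: measurable_fun_ifT; meas.
  - by nneg.
  apply: eq_intp => z _.
  rewrite muleA -EFinM mulrCA -expRD -/(k x z) subr_ge0.
  by case: leP => _; rewrite eindT eindF !mul1e !mul0e !mule0 ?adde0 ?add0e.
congr (_ + _).
  rewrite intp_swap; last 2 first.
  - by nneg.
  - by rewrite /k; meas.
  transitivity (\intp_z ((q * expR (- ((q + s) * z)))%:E * \intp_x ((expR (- (s * x)))%:E * f x))).
    apply: eq_intp => z z0.
    transitivity (\intp_x (eind (z <= x)%R * ((k x z)%:E * f (x - z)%R))).
      by apply: eq_intp => x _; rewrite muleCA.
    rewrite -(@intp_shift _ (fun x => (k x z)%:E * f (x - z)%R))//; last 2 first.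
    - by rewrite /k; meas.
    - by nneg.
    rewrite -intpZl; last first.
    - by nneg.
    - by meas.
    - by nneg.
    apply: eq_intp => x _; rewrite addrK muleA -EFinM /k -mulrA -expRD.
    by congr ((q * expR _)%:E * _); ring.
  rewrite intpZr ?intp_expR_scaled//.
  - exact: ltW.
  - by nneg.
  - by meas.
  - by nneg.
transitivity (\intp_x ((1 * expR (- ((q + s) * x)))%:E *
    \intp_w ((q * expR (- (q * w)))%:E * chi w))).
  apply: eq_intp => x x0.
  transitivity (\intp_z (eind (x <= z)%R * ((k x z)%:E * chi (z - x)%R))).
    apply: (@eq_intp_but _ _ _ x).
    - by rewrite /k; meas.
    - by rewrite /k; meas.
    by move=> z _ zx; rewrite muleCA lt_def zx.
  rewrite -(@intp_shift _ (fun z => (k x z)%:E * chi (z - x)%R))//; last 2 first.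
  - by rewrite /k; meas.
  - by nneg.
  rewrite -intpZl; last first.
  - by nneg.
  - by meas.
  - by nneg.
  apply: eq_intp => w _; rewrite addrK muleA -EFinM /k mulrCA mul1r -expRD.
  by congr ((q * expR _)%:E * _); ring.
by rewrite intpZr ?intp_expR_scaled//; try by [nneg|meas].
Qed.

(** In integrated form, [(q - r s) B = q (L phi s - L phi (q / r))] for the
    Laplace transform [L]: with [v = y + r * w] the weight of [phi v] in [B] is a
    truncated exponential integral of rate [q - r s]. The terms are placed so
    that both sides are sums of nonnegative terms, possibly infinite. *)
Lemma spill_transform (q r s : R) (phi : R -> \bar R) :
  (0 < q)%R -> (0 < r)%R -> (0 < s)%R ->
  (forall x, 0 <= phi x) -> measurable_fun setT phi ->
  let B := \intp_y ((expR (- (s * y)))%:E *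
     \intp_w ((q * expR (- (q * w)))%:E * phi (y + r * w)%R)) in
  q%:E * B + q%:E * \intp_v ((expR (- (q / r * v)))%:E * phi v) =
  q%:E * \intp_v ((expR (- (s * v)))%:E * phi v) + (r * s)%:E * B.
Proof.
move=> q0 r0 s0 phi0 mphi /=.
pose J (v : R) := \intp_w (eind (w <= v / r)%R * (expR (- ((q - r * s) * w)))%:E).
have J0 v : 0 <= J v by rewrite /J; nneg.
have mJ : measurable_fun setT J by rewrite /J; meas.
rewrite (_ : \intp_y _ = \intp_v ((q%:E * J v) * ((expR (- (s * v)))%:E * phi v))); last first.
  pose k (w v : R) := (q * expR (- (q * w) - s * (v - r * w)))%R.
  have k0 w v : (0 <= k w v)%R by rewrite /k; nneg.
  transitivity (\intp_y \intp_w ((k w (y + r * w)%R)%:E * phi (y + r * w)%R)).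
    apply: eq_intp => y _; rewrite -intpZl; last first.
    - by nneg.
    - by meas.
    - by nneg.
    apply: eq_intp => w _; rewrite muleA -EFinM /k mulrCA -expRD addrK.
    by congr ((q * expR _)%:E * _); ring.
  rewrite intp_swap; last 2 first.
  - by nneg.
  - by rewrite /k; meas.
  transitivity (\intp_w \intp_v (eind (r * w <= v)%R * ((k w v)%:E * phi v))).
    apply: eq_intp => w w0; rewrite -intp_shift//; last first.
    - by nneg.
    - by rewrite /k; meas.
    - by rewrite mulr_ge0// ltW.
  rewrite intp_swap; last 2 first.
  - by nneg.
  - by rewrite /k; meas.
  apply: eq_intp => v _; rewrite /J -intpZl; last first.
  - by nneg.
  - by meas.
  - by nneg.
  rewrite -intpZr; last first.
  - by nneg.
  - by meas.
  - by nneg.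
  apply: eq_intp => w _; rewrite ler_pdivlMr// [(w * r)%R]mulrC [q%:E * (_ * _)]muleCA -!muleA.
  congr (_ * _); rewrite !muleA -!EFinM; congr (_%:E * _).
  by rewrite /k -mulrA -expRD; congr (_ * expR _)%R; ring.
have mphi' r' : measurable_fun setT (fun v : R => (expR (- (r' * v)))%:E * phi v) by meas.
have phi'0 r' v : 0 <= (expR (- (r' * v)))%:E * phi v by nneg.
have mJphi : measurable_fun setT
  (fun v => (q%:E * J v) * ((expR (- (s * v)))%:E * phi v)) by meas.
have Jphi0 v : 0 <= (q%:E * J v) * ((expR (- (s * v)))%:E * phi v) by nneg.
have q0' : 0 <= q%:E by nneg.
have rs0 : 0 <= (r * s)%:E by nneg.
rewrite -(intpZl q0' mJphi Jphi0) -(intpZl rs0 mJphi Jphi0).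
rewrite -(intpZl q0' (mphi' (q / r)%R) (phi'0 (q / r)%R)) -(intpZl q0' (mphi' s) (phi'0 s)).
rewrite -intpD; last first.
- by nneg.
- by meas.
- by nneg.
- by meas.
rewrite -intpD; last first.
- by nneg.
- by meas.
- by nneg.
- by meas.
apply: eq_intp => v v0.
have := @intp_expR_trunc _ (q - r * s) (v / r).
rewrite divr_ge0// 1?ltW// => /(_ isT) [Jfin]; rewrite -/(J v) in Jfin *.
rewrite -(fineK Jfin) -EFinM => -[kJ].
have Jv0 : (0 <= fine (J v))%R by rewrite fine_ge0.
rewrite !muleA -!EFinM -!ge0_muleDl; try by nneg.
rewrite -!EFinD; congr (_%:E * _).
have -> : expR (- (q / r * v)) =
    (expR (- (s * v)) * expR (- ((q - r * s) * (v / r))))%R.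
  by rewrite -expRD; congr expR; field; rewrite gt_eqF.
have := congr1 (fun t => q * expR (- (s * v)) * t)%R kJ.
by lra.
Qed.
End jump.

(** * Laplace transforms of bounded functions *)

Section laplace.
Context {R : realType}.
Local Notation leb := (@lebesgue_measure R).
Implicit Types (f : R -> R) (s M : R).

Lemma integrable_laplace f s M : 0 < s -> measurable_fun setT f ->
  (forall x, 0 <= f x <= M) ->
  leb.-integrable `[0, +oo[ (EFin \o (fun x => expR (- (s * x)) * f x)).
Proof.
move=> s0 mf fM.
have M0 : 0 <= M by have /andP[a b] := fM 0; exact: le_trans b.
apply/integrableP; split; first by apply: measurable_funTS; rewrite /comp; meas.
apply: (@le_lt_trans _ _ (\intp_x (M * expR (- (s * x)))%:E)%E); last first.
  by rewrite intp_expR_scaled ?ltry.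
apply: ge0_le_integral => //.
- by apply: measurable_funTS; apply: measurableT_comp => //; rewrite /comp; meas.
- by apply: measurable_funTS; meas.
- move=> x _ /=; have /andP[fx0 fxM] := fM x.
  by rewrite lee_fin ger0_norm ?mulr_ge0 ?expR_ge0// mulrC ler_wpM2r ?expR_ge0.
Qed.

Lemma laplaceE f s M : 0 < s -> measurable_fun setT f ->
  (forall x, 0 <= f x <= M) ->
  (\intp_x ((expR (- (s * x)))%:E * (f x)%:E))%E = (laplace f s)%:E.
Proof.
move=> s0 mf fM; rewrite /laplace /Rintegral fineK//.
exact/integrable_fin_num/integrable_laplace.
Qed.

Lemma laplace_ge0 f s : (forall x, 0 <= f x) -> 0 <= laplace f s.
Proof. by move=> f0; apply: Rintegral_ge0 => x _; nneg. Qed.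

Lemma laplace_le f s M : 0 < s -> measurable_fun setT f ->
  (forall x, 0 <= f x <= M) -> laplace f s <= M / s.
Proof.
move=> s0 mf fM.
have M0 : 0 <= M by have /andP[a b] := fM 0; exact: le_trans b.
rewrite -lee_fin -(laplaceE s0 mf fM) -intp_expR_scaled//.
apply: ge0_le_integral => //.
- by move=> x _; have /andP[fx0 fxM] := fM x; nneg.
- by apply: measurable_funTS; meas.
- by apply: measurable_funTS; meas.
- move=> x _ /=; have /andP[fx0 fxM] := fM x.
  by rewrite -EFinM lee_fin mulrC ler_wpM2r ?expR_ge0.
Qed.

(** Dominated convergence, the exponential of rate [a / 2] being a bound for all
    parameters near [a]. *)
Lemma laplace_continuous f M a : 0 < a -> measurable_fun setT f ->
  (forall x, 0 <= f x <= M) -> {for a, continuous (laplace f)}.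
Proof.
move=> a0 mf fM.
have M0 : 0 <= M by have /andP[u v] := fM 0; exact: le_trans v.
have a20 : 0 < a / 2 by rewrite divr_gt0.
have -> : laplace f = fun l => \int[leb]_(x in `[0, +oo[) (expR (- (l * x)) * f x) by [].
apply: (@continuity_under_integral _ _ _ leb (fun l x => expR (- (l * x)) * f x)
  _ _ (a / 2) (2 * a) _ _ (fun x => expR (- (a / 2 * x)) * M)) => //.
- move=> x /=; rewrite in_itv/= => /andP[ax _].
  by apply: integrable_laplace fM => //; exact: lt_trans ax.
- apply/aeW => y _ l _.
  apply: (@continuousM _ R^o (fun l => expR (- (l * y))) (fun=> f y)); last exact: cst_continuous.
  apply: continuous_comp; last exact: continuous_expR.
  by apply: continuousN; exact: mulrr_continuous.
- by apply: (@integrable_laplace (fun=> M) _ M) => // x; rewrite M0 lexx.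
- move=> l; rewrite /= in_itv/= => /andP[al _]; apply/aeW => y.
  rewrite /= in_itv/= andbT => y0; have /andP[fx0 fxM] := fM y.
  rewrite ger0_norm ?mulr_ge0 ?expR_ge0// ler_pM ?expR_ge0//.
  by rewrite ler_expR lerN2 ler_wpM2r// ltW.
- by rewrite inE/= in_itv/=; apply/andP; split; lra.
Qed.

Lemma laplace2E (f : R -> R -> R) s1 s2 M : 0 < s1 -> 0 < s2 ->
  measurable_fun setT (fun w : R * R => f w.1 w.2) ->
  (forall x y, 0 <= f x y <= M) ->
  (\intp_v \intp_u ((expR (- (s1 * u) - s2 * v))%:E * (f u v)%:E))%E =
  (laplace2 f s1 s2)%:E.
Proof.
move=> s10 s20 mf fM.
have mfv v : measurable_fun setT (f ^~ v) by meas.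
have E v : (\intp_u ((expR (- (s1 * u) - s2 * v))%:E * (f u v)%:E) =
    (expR (- (s2 * v)))%:E * (laplace (f ^~ v) s1)%:E)%E.
  rewrite -(laplaceE s10 (mfv v) (fM ^~ v)) -intpZl; last first.
  - by move=> u; have /andP[? _] := fM u v; nneg.
  - by meas.
  - by nneg.
  by apply: eq_intp => u _; rewrite muleA -[in RHS]EFinM -expRD addrC.
rewrite (_ : laplace2 f s1 s2 = laplace (fun v => laplace (f ^~ v) s1) s2).
  rewrite -(@laplaceE _ _ (M / s1))//.
  - by apply: eq_intp => v _; exact: E.
  - rewrite /laplace /Rintegral.
    apply: (@measurableT_comp _ _ _ _ _ _ (@fine R)) => //.
    apply: measurable_intp; last by meas.
    by move=> v u; have /andP[? _] := fM u v; nneg.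
  - move=> v; rewrite laplace_le// andbT laplace_ge0// => u.
    by have /andP[] := fM u v.
rewrite /laplace2 /laplace; apply: eq_Rintegral => v _.
rewrite -/(laplace (f ^~ v) s1) /Rintegral.
under eq_integral do rewrite EFinM.
by rewrite E -EFinM.
Qed.
End laplace.

(** * The kernel equation *)

Definition jump_mean {R : realType} (q r : R) (f : R -> R -> R) (x y : R) : \bar R :=
  (\intp_z ((q * expR (- (q * z)))%:E *
     (let w := reflect_jump r (x - z)%R y in f w.1 w.2)%:E))%E.

Section jump_mean.
Context {R : realType}.
Local Open Scope ereal_scope.
Variables (q r : R) (f : R -> R -> R).
Hypotheses (q0 : (0 < q)%R) (r0 : (0 < r)%R).
Hypothesis mf : measurable_fun setT (fun w : R * R => f w.1 w.2).
Hypothesis f01 : forall x y, (0 <= f x y <= 1)%R.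

Let f0 x y : (0 <= f x y)%R. Proof. by have /andP[] := f01 x y. Qed.

Lemma jump_meanE x y : jump_mean q r f x y =
  \intp_z ((q * expR (- (q * z)))%:E * (if (0 <= x - z)%R then (f (x - z) y)%:E
      else (f 0 (y + r * (z - x)))%:E)).
Proof.
apply: eq_intp => z _; congr (_ * _); rewrite /reflect_jump.
by case: leP => // xz; rewrite ltr0_norm// opprB.
Qed.

Lemma measurable_jump_mean :
  measurable_fun setT (fun w : R * R => jump_mean q r f w.1 w.2).
Proof.
rewrite (_ : (fun w => _) = (fun w : R * R => \intp_z ((q * expR (- (q * z)))%:E *
  (if (0 <= w.1 - z)%R then (f (w.1 - z) w.2)%:E
      else (f 0 (w.2 + r * (z - w.1)))%:E)))); last first.
  by apply/funext => w; rewrite jump_meanE.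
apply: measurable_intp; cbv beta.
  by move=> w z; case: ifPn => _; nneg.
apply: emeasurable_funM; first by meas.
by apply: measurable_fun_ifT; meas.
Qed.

Lemma jump_mean_ge0 x y : 0 <= jump_mean q r f x y.
Proof. by rewrite /jump_mean; nneg. Qed.

(** By the lack of memory the undershoot of an exponential jump below 0 is
    exponential whatever the starting point, so its effect on the second
    component depends on [y] alone. *)
Definition spill (y : R) : R :=
  fine (\intp_w ((q * expR (- (q * w)))%:E * (f 0 (y + r * w)%R)%:E)).

Lemma spillE y :
  \intp_w ((q * expR (- (q * w)))%:E * (f 0 (y + r * w)%R)%:E) = (spill y)%:E /\
  (0 <= spill y <= 1)%R.
Proof.
have I0 : 0 <= \intp_w ((q * expR (- (q * w)))%:E * (f 0 (y + r * w)%R)%:E) by nneg.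
have I1 : \intp_w ((q * expR (- (q * w)))%:E * (f 0 (y + r * w)%R)%:E) <= 1.
  rewrite -(intp_expR q0); apply: ge0_le_integral => //.
  - by move=> x _; nneg.
  - by apply: measurable_funTS; meas.
  - by apply: measurable_funTS; meas.
  - move=> w _; have /andP[_ f1] := f01 0 (y + r * w).
    by rewrite -EFinM lee_fin ler_piMr// mulr_ge0 ?expR_ge0// ltW.
have Ifin : \intp_w ((q * expR (- (q * w)))%:E * (f 0 (y + r * w)%R)%:E) \is a fin_num.
  by rewrite ge0_fin_numE// (le_lt_trans I1)// ltry.
rewrite /spill fineK//; split => //.
by rewrite -!lee_fin fineK// I0 I1.
Qed.

Lemma measurable_spill : measurable_fun setT spill.
Proof. by apply: (@measurableT_comp _ _ _ _ _ _ (@fine R)) => //; meas. Qed.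

Lemma jump_mean_transform (s1 s2 : R) : (0 < s1)%R -> (0 < s2)%R ->
  \intp_y \intp_x ((expR (- (s1 * x) - s2 * y))%:E * jump_mean q r f x y) =
  (q / (q + s1) * laplace2 f s1 s2 + laplace spill s2 / (q + s1))%:E.
Proof.
move=> s10 s20.
have qs0 : (0 < q + s1)%R by rewrite addr_gt0.
have qq0 : (0 <= q / (q + s1))%R by rewrite divr_ge0 // ltW.
have q10 : (0 <= 1 / (q + s1))%R by rewrite divr_ge0 // ltW.
transitivity (\intp_y ((q / (q + s1))%:E *
    \intp_x ((expR (- (s1 * x) - s2 * y))%:E * (f x y)%:E)
  + (1 / (q + s1))%:E * ((expR (- (s2 * y)))%:E * (spill y)%:E))).
  apply: eq_intp => y _.
  transitivity ((expR (- (s2 * y)))%:E *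
     \intp_x ((expR (- (s1 * x)))%:E * jump_mean q r f x y)).
    rewrite -intpZl; last first.
    - by move=> x; rewrite mule_ge0 ?jump_mean_ge0// lee_fin expR_ge0.
    - apply: emeasurable_funM; first by meas.
      by apply: (measurable_comp2 measurable_jump_mean); meas.
    - by nneg.
    by apply: eq_intp => x _; rewrite muleA -EFinM -expRD addrC.
  have -> : \intp_x ((expR (- (s1 * x)))%:E * jump_mean q r f x y) =
    (q / (q + s1))%:E * \intp_x ((expR (- (s1 * x)))%:E * (f x y)%:E) +
    (1 / (q + s1))%:E * (spill y)%:E.
    have [<- _] := spillE y.
    rewrite (eq_intp (g := fun x => _ * _) (fun x _ => congr1 _ (jump_meanE x y))).
    apply: (jump_transform1 (f := fun x => (f x y)%:E)
      (chi := fun w => (f 0 (y + r * w))%:E)) => //; by [nneg|meas].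
  rewrite ge0_muleDr; last 2 first.
  - by nneg.
  - by have [_ /andP[? _]] := spillE y; nneg.
  congr (_ + _); last by rewrite muleCA.
  rewrite muleCA; congr (_ * _); rewrite -intpZl; last first.
  - by nneg.
  - by meas.
  - by nneg.
  by apply: eq_intp => x _; rewrite muleA -[in LHS]EFinM -expRD addrC.
have mS := measurable_spill.
have S01 y := (spillE y).2.
have S0 y : (0 <= spill y)%R by have /andP[] := S01 y.
rewrite intpD; last first.
- by nneg.
- by meas.
- by nneg.
- by meas.
rewrite !intpZl; try by [nneg|meas].
by rewrite (laplace2E s10 s20 mf f01) (laplaceE s20 mS S01) -!EFinM -EFinD mul1r
  [(_^-1 * _)%R]mulrC.
Qed.

(** As [f] is bounded all terms of [spill_transform] are finite, so it can be
    solved for the difference. *)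
Lemma spill_laplace s : (0 < s)%R ->
  ((q - r * s) * laplace spill s =
   q * (laplace (f 0) s - laplace (f 0) (q / r)))%R.
Proof.
move=> s0.
have mf0 : measurable_fun setT (f 0%R)
  by exact: (measurableT_comp mf (pair1_measurable (0 : R)%R)).
have := @spill_transform _ q r s (fun y => (f 0 y)%:E) q0 r0 s0 (f0 0).
move=> /(_ (measurableT_comp (@EFin_measurable _ _) mf0)) /=.
rewrite (laplaceE s0 mf0 (f01 0)) (laplaceE (divr_gt0 q0 r0) mf0 (f01 0)).
rewrite (_ : \intp_y _ = (laplace spill s)%:E).
  by rewrite -!EFinM -!EFinD => -[h]; lra.
rewrite -(laplaceE s0 measurable_spill (fun y => (spillE y).2)).
by apply: eq_intp => y _; have [-> _] := spillE y.
Qed.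

(** By [spill_laplace] the quotient of the difference by [q - r * x] is, away
    from [q / r], a multiple of the Laplace transform of the bounded function
    [spill], which is continuous at [q / r] as well: the pole is removed by the
    zero of the difference, and the value by continuity is the one that the
    Laplace transform of [spill] gives. *)
Lemma removable_pole (c lam s : R) (G : R -> R) : (0 < s)%R ->
  let F := laplace (f 0) in
  (forall x, G x = (c - lam * q / ((q + s) * (q - r * x))) * (F x - F (q / r)))%R ->
  let V x := (c * (F x - F (q / r)) - lam / (q + s) * laplace spill x)%R in
  (G x @[x --> (q / r)%R^'] --> V (q / r)%R) /\
  (forall x, (0 < x)%R -> by_continuity (q / r)%R G x = V x).
Proof.
move=> s0 F GE V.
have mf0 : measurable_fun setT (f 0%R)
  by exact: (measurableT_comp mf (pair1_measurable (0 : R)%R)).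
have qr0 : (0 < q / r)%R by rewrite divr_gt0.
have GV x : (0 < x)%R -> x != (q / r)%R -> G x = V x.
  move=> x0 xqr; rewrite GE /V mulrBl; congr (_ - _)%R.
  have qrx : (q - r * x)%R != 0%R.
    by apply: contra_neq xqr => /subr0_eq ->; field; rewrite gt_eqF.
  have -> : laplace spill x = (q * (F x - F (q / r)) / (q - r * x))%R.
    by apply/(mulfI qrx); rewrite spill_laplace//; rewrite mulrCA divff// mulr1.
  by field; rewrite qrx gt_eqF// addr_gt0.
have cG : (G x @[x --> (q / r)%R^'] --> V (q / r)%R).
  have cV : (V x @[x --> (q / r)%R^'] --> V (q / r)%R).
    have cF := laplace_continuous qr0 mf0 (f01 0).
    have cS := laplace_continuous qr0 measurable_spill (fun y => (spillE y).2).
    apply: cvg_within_filter; apply: cvgB; apply: cvgMr.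
      by apply: cvgB; [exact: cF|exact: cvg_cst].
    exact: cS.
  apply: cvg_trans cV; apply: near_eq_cvg; near=> x.
  apply/esym/GV; near: x.
    by apply: nbhs_dnbhs; exact: lt_nbhsr.
  exact: nbhs_dnbhs_neq.
split=> // x x0; rewrite /by_continuity; case: eqP => [->|/eqP xqr]; last exact: GV.
exact: cvg_lim.
Unshelve. all: by end_near. Qed.
End jump_mean.

Section analytic.
Context {R : realType}.
Variables (c1 c2 lam1 lam2 q1 q2 r1 r2 : R).
Hypotheses (c1_gt0 : 0 < c1) (c2_gt0 : 0 < c2).
Hypotheses (lam1_gt0 : 0 < lam1) (lam2_gt0 : 0 < lam2).
Hypotheses (q1_gt0 : 0 < q1) (q2_gt0 : 0 < q2).
Hypotheses (r1_gt0 : 0 < r1) (r2_gt0 : 0 < r2).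
Variable p : R -> R -> R.
Hypothesis mp : measurable_fun setT (fun w : R * R => p w.1 w.2).
Hypothesis p01 : forall x y, 0 <= p x y <= 1.

Hypothesis first_jump : forall u v, 0 <= u -> 0 <= v ->
  (p u v)%:E =
  (\intp_a ((lam1 * expR (- ((lam1 + lam2) * a)))%:E *
     jump_mean q1 r1 p (u + c1 * a)%R (v + c2 * a)%R) +
   \intp_a ((lam2 * expR (- ((lam1 + lam2) * a)))%:E *
     jump_mean q2 r2 (fun y x => p x y) (v + c2 * a)%R (u + c1 * a)%R))%E.

(** [walk_balance] for the mean [g] after the jump turns the first-jump equation
    into a linear relation between the transforms of [p], of its two boundary
    values and of [g]; [jump_mean_transform] expresses the last by the
    transforms of [p] and of the two spills, and [removable_pole] the spills by
    the boundary values. *)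
Theorem kernel_equation (s1 s2 : R) : 0 < s1 -> 0 < s2 ->
  let F1 := laplace (fun u => p u 0) in
  let F2 := laplace (fun v => p 0 v) in
  let G1 x := kernel1 c2 lam2 q2 r2 x s2 * (F1 x - F1 (q2 / r2)) in
  let G2 x := kernel2 c1 lam1 q1 r1 s1 x * (F2 x - F2 (q1 / r1)) in
  [/\ cvg (G1 x @[x --> (q2 / r2)^']),
      cvg (G2 x @[x --> (q1 / r1)^']) &
      laplace_exponent c1 c2 lam1 lam2 q1 q2 s1 s2 * laplace2 p s1 s2 =
        by_continuity (q2 / r2) G1 s1 + by_continuity (q1 / r1) G2 s2
        + (c2 * F1 (q2 / r2) + c1 * F2 (q1 / r1))].
Proof.
move=> s10 s20 F1 F2 G1 G2.
pose p' y x := p x y.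
have mp' : measurable_fun setT (fun w : R * R => p' w.1 w.2) by rewrite /p'; meas.
have p'01 x y : 0 <= p' x y <= 1 by exact: p01.
have p0 x y : 0 <= p x y by have /andP[] := p01 x y.
have [cG1 G1E] := removable_pole q2_gt0 r2_gt0 mp' p'01 s20 (G := G1) (fun x => erefl).
have [cG2 G2E] := removable_pole q1_gt0 r1_gt0 mp p01 s10 (G := G2) (fun x => erefl).
split; [by apply/cvg_ex; eexists; exact: cG1
       |by apply/cvg_ex; eexists; exact: cG2|].
rewrite G1E// G2E// -/F1 -/F2.
pose g x y := (lam1%:E * jump_mean q1 r1 p x y + lam2%:E * jump_mean q2 r2 p' y x)%E.
have mj1 := measurable_jump_mean r1 q1_gt0 mp p01.
have mj2 := measurable_jump_mean r2 q2_gt0 mp' p'01.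
have j10 := jump_mean_ge0 r1 q1_gt0 p01.
have j20 := jump_mean_ge0 r2 q2_gt0 p'01.
have g0 x y : (0 <= g x y)%E by rewrite /g; nneg.
have mg : measurable_fun setT (fun w : R * R => g w.1 w.2) by rewrite /g; meas.
have TE u v : 0 <= u -> 0 <= v -> (\intp_a ((expR (- ((lam1 + lam2) * a)))%:E *
    g (u + c1 * a)%R (v + c2 * a)%R) = (p u v)%:E)%E.
  move=> u0 v0; rewrite first_jump// -intpD; last first.
  - by nneg.
  - by meas.
  - by nneg.
  - by meas.
  apply: eq_intp => a _; rewrite /g ge0_muleDr; last 2 first.
  - by nneg.
  - by nneg.
  by rewrite !muleA -!EFinM ![expR _ * _]mulrC.
have EF : (\intp_v \intp_u ((expR (- (s1 * u) - s2 * v))%:E *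
    \intp_a ((expR (- ((lam1 + lam2) * a)))%:E *
      g (u + c1 * a)%R (v + c2 * a)%R)) = (laplace2 p s1 s2)%:E)%E.
  rewrite -(laplace2E s10 s20 mp p01).
  by apply: eq_intp => v v0; apply: eq_intp => u u0; rewrite TE.
have EF1 : (\intp_u ((expR (- (s1 * u)))%:E *
    \intp_a ((expR (- ((lam1 + lam2) * a)))%:E *
      g (u + c1 * a)%R (0 + c2 * a)%R)) = (F1 s1)%:E)%E.
  have mp1 : measurable_fun setT (fun u => p u 0) by meas.
  by rewrite -(laplaceE s10 mp1 (p01 ^~ 0)); apply: eq_intp => u u0; rewrite TE.
have EF2 : (\intp_v ((expR (- (s2 * v)))%:E *
    \intp_a ((expR (- ((lam1 + lam2) * a)))%:E *
      g (0 + c1 * a)%R (v + c2 * a)%R)) = (F2 s2)%:E)%E.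
  have mp2 : measurable_fun setT (fun v => p 0 v) by meas.
  by rewrite -(laplaceE s20 mp2 (p01 0)); apply: eq_intp => u u0; rewrite TE.
have F_swap : laplace2 p' s2 s1 = laplace2 p s1 s2.
  apply: EFin_inj; rewrite -(laplace2E s20 s10 mp' p'01) -(laplace2E s10 s20 mp p01).
  rewrite intp_swap; last 2 first.
  - by rewrite /p'; nneg.
  - by meas.
  by apply: eq_intp => x _; apply: eq_intp => y _; rewrite addrC.
pose L1 := q1 / (q1 + s1) * laplace2 p s1 s2 + laplace (spill q1 r1 p) s2 / (q1 + s1).
pose L2 := q2 / (q2 + s2) * laplace2 p s1 s2 + laplace (spill q2 r2 p') s1 / (q2 + s2).
have EL1 := jump_mean_transform r1 q1_gt0 mp p01 s10 s20.
have EL2 : (\intp_y \intp_x ((expR (- (s1 * x) - s2 * y))%:E * jump_mean q2 r2 p' y x) =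
    L2%:E)%E.
  rewrite /L2 -F_swap -(jump_mean_transform r2 q2_gt0 mp' p'01 s20 s10).
  transitivity (\intp_x \intp_y ((expR (- (s1 * x) - s2 * y))%:E *
      jump_mean q2 r2 p' y x))%E.
    by apply: intp_swap; [nneg|meas].
  by apply: eq_intp => x _; apply: eq_intp => y _; rewrite addrC.
have EG : (\intp_y \intp_x ((expR (- (s1 * x) - s2 * y))%:E * g x y) =
    lam1%:E * L1%:E + lam2%:E * L2%:E)%E.
  rewrite -EL2 /L1 -EL1.
  rewrite -(intp2Zl (k := lam1%:E) (f := fun x y =>
    (expR (- (s1 * x) - s2 * y))%:E * jump_mean q1 r1 p x y)%E); last 3 first.
  - by rewrite lee_fin ltW.
  - by meas.
  - by nneg.
  rewrite -(intp2Zl (k := lam2%:E) (f := fun x y =>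
    (expR (- (s1 * x) - s2 * y))%:E * jump_mean q2 r2 p' y x)%E); last 3 first.
  - by rewrite lee_fin ltW.
  - by meas.
  - by nneg.
  rewrite -(@intp2D _
    (fun x y => lam1%:E * ((expR (- (s1 * x) - s2 * y))%:E * jump_mean q1 r1 p x y))%E
    (fun x y => lam2%:E * ((expR (- (s1 * x) - s2 * y))%:E * jump_mean q2 r2 p' y x))%E);
    last first.
  - by nneg.
  - by meas.
  - by nneg.
  - by meas.
  apply: eq_intp => y _; apply: eq_intp => x _.
  rewrite /g ge0_muleDr; [|by nneg..].
  by congr (_ + _)%E; rewrite muleCA.
have : ((lam1 + lam2)%:E * (laplace2 p s1 s2)%:E + c2%:E * (F1 s1)%:E + c1%:E * (F2 s2)%:E =
    (lam1%:E * L1%:E + lam2%:E * L2%:E) + (s1 * c1 + s2 * c2)%:E * (laplace2 p s1 s2)%:E)%E.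
  rewrite -EF -EF1 -EF2 -EG.
  exact: (walk_balance c1_gt0 c2_gt0 (ltW (addr_gt0 lam1_gt0 lam2_gt0))
    (ltW s10) (ltW s20) g0 mg).
rewrite -!EFinM -!EFinD => -[E].
rewrite /laplace_exponent.
have qs1 : q1 + s1 != 0 by rewrite gt_eqF// addr_gt0.
have qs2 : q2 + s2 != 0 by rewrite gt_eqF// addr_gt0.
have -> : lam1 / (1 + s1 / q1) = lam1 * (q1 / (q1 + s1)).
  by field; rewrite qs1 !gt_eqF.
have -> : lam2 / (1 + s2 / q2) = lam2 * (q2 / (q2 + s2)).
  by field; rewrite qs2 !gt_eqF.
move: E; rewrite /L1 /L2.
move: (laplace2 p s1 s2) (F1 s1) (F1 _) (F2 s2) (F2 _)
  (laplace (spill q1 r1 p) s2) (laplace (spill q2 r2 p') s1) => F x1 x1' x2 x2' y1 y2 E.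
by lra.
Qed.
End analytic.

(** * Arrays of independent variables *)

Section streams.
Context {R : realType}.

Definition streams := 'I_4 -> nat -> R.

Definition box (B : 'I_4 -> nat -> set R) : set streams :=
  [set z | forall s n, B s n (z s n)].

(** Constraints on finitely many coordinates. The bound on the column is common
    to the four rows, so that the probability of a box is a product over a
    rectangle. *)
Definition is_box (C : set streams) : Prop := exists N B,
  [/\ forall s n, measurable (B s n), forall s n, (N <= n)%N -> B s n = setT
    & C = box B].

Definition stream_space := g_sigma_algebraType is_box.

Lemma setI_closed_box : setI_closed is_box.
Proof.
move=> _ _ [N [B [mB BN ->]]] [N' [B' [mB' BN' ->]]].
exists (maxn N N'), (fun s n => B s n `&` B' s n); split.
- by move=> s n; exact: measurableI.
- by move=> s n; rewrite geq_max => /andP[Nn N'n]; rewrite BN// BN'// setTI.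
- apply/seteqP; split => z; first by move=> [zB zB'] s n; split; [exact: zB|exact: zB'].
  by move=> zBB'; split=> s n; have [] := zBB' s n.
Qed.

Lemma is_boxT : is_box setT.
Proof. by exists 0%N, (fun _ _ => setT); split => //; apply/seteqP; split. Qed.

Lemma measurable_box B N : (forall s n, measurable (B s n)) ->
  (forall s n, (N <= n)%N -> B s n = setT) ->
  measurable (box B : set stream_space).
Proof. by move=> mB BN; apply: sub_sigma_algebra; exists N, B. Qed.

Lemma measurable_coordinate s n :
  measurable_fun setT (fun z : stream_space => z s n).
Proof.
move=> _ B mB; rewrite setTI.
pose B' s' n' := if (s' == s) && (n' == n) then B else setT.
rewrite (_ : _ @^-1` _ = box B').
  apply: (@measurable_box _ n.+1) => s' n'; rewrite /B'; first by case: ifP.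
  by case: ifP => // /andP[_ /eqP ->]; rewrite ltnn.
apply/seteqP; split=> z /=.
  by move=> zB s' n'; rewrite /B'; case: ifP => // /andP[/eqP -> /eqP ->].
by move=> /(_ s n); rewrite /B' !eqxx.
Qed.

Lemma measurable_streams d (T : measurableType d) (f : T -> stream_space) :
  (forall s n, measurable_fun setT (fun t => f t s n)) -> measurable_fun setT f.
Proof.
move=> mf; apply: (@measurability _ _ T stream_space setT f is_box) => //.
move=> _ [_ [N [B [mB BN ->]]] <-]; rewrite setTI.
rewrite (_ : _ @^-1` _ = \bigcap_s \bigcap_n (fun t => f t s n) @^-1` B s n).
  apply: fin_bigcap_measurable; first exact: finite_finset.
  move=> s _; apply: bigcapT_measurable => n.
  by rewrite -[X in measurable X]setTI; exact: mf.
by apply/seteqP; split=> t /=; [move=> h s _ n _; exact: h|move=> h s n; exact: h].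
Qed.

Section box_law.
Variable law : 'I_4 -> {measure set R -> \bar R}.

(** All entries are independent, those of row [s] with law [law s]: the boxes
    form a pi-system that generates the sigma-algebra, so this determines [Q]. *)
Definition box_law (Q : set stream_space -> \bar R) := forall N B,
  (forall s n, measurable (B s n)) ->
  (forall s n, (N <= n)%N -> B s n = setT) ->
  Q (box B) = (\prod_(s < 4) \prod_(n < N) law s (B s n))%E.

Lemma box_law_unique (Q Q' : {measure set stream_space -> \bar R}) :
  (Q setT < +oo)%E ->
  box_law Q -> box_law Q' -> forall A, measurable A -> Q A = Q' A.
Proof.
move=> Qoo QE Q'E A mA.
apply: (@measure_unique _ R stream_space is_box (fun=> setT) _ _ _ _ Q Q') => //.
- exact: setI_closed_box.
- by move=> _; exact: is_boxT.
- by apply/seteqP; split => // z _; exists 0%N.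
- by move=> C [N [B [mB BN ->]]]; rewrite (QE N)// (Q'E N).
Qed.
End box_law.

Definition prepend (s : 'I_4) (a : R) (z : streams) : streams := fun s' n =>
  if s' == s then (if n is n'.+1 then z s n' else a) else z s' n.

Lemma prepend_same s a z n :
  prepend s a z s n = if n is n'.+1 then z s n' else a.
Proof. by rewrite /prepend eqxx. Qed.

Lemma prepend_other s a z s' : s' != s -> prepend s a z s' = z s'.
Proof. by rewrite /prepend => /negbTE ->. Qed.

Lemma measurable_prepend s :
  measurable_fun setT (fun w : R * stream_space => prepend s w.1 w.2 : stream_space).
Proof.
apply: measurable_streams => s' n; rewrite /prepend.
case: eqP => _; last first.
  exact: (measurableT_comp (measurable_coordinate s' n) measurable_snd).
case: n => [|n]; first exact: measurable_fst.
exact: (measurableT_comp (measurable_coordinate s n) measurable_snd).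
Qed.

Lemma measurable_prepend2 s a :
  measurable_fun setT (fun z : stream_space => prepend s a z : stream_space).
Proof. exact: (measurableT_comp (measurable_prepend s) (pair1_measurable a)). Qed.

Section integral_prepend.
Local Open Scope ereal_scope.
Variable law : 'I_4 -> probability R R.
Variable Q : probability stream_space R.
Hypothesis QE : box_law law Q.

Let tail_box s (B : 'I_4 -> nat -> set R) s' n :=
  if s' == s then B s n.+1 else B s' n.

(** An independent entry put in front of a row shifts the i.i.d. sequence in
    that row by one place, which does not change the law of the array. *)
Lemma box_law_prepend s :
  box_law law (image_measure (law s \x Q) (measurable_prepend s)).
Proof.
move=> N B mB BN.
have mB' s' n : measurable (tail_box s B s' n) by rewrite /tail_box; case: ifP.
have B'N s' n : (N <= n)%N -> tail_box s B s' n = setT.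
  by move=> Nn; rewrite /tail_box; case: ifP => _; rewrite BN// leqW.
rewrite /= /pushforward.
rewrite (_ : _ @^-1` _ = B s 0%N `*` box (tail_box s B)); last first.
  apply/seteqP; split=> -[a z] /=.
    move=> zB; split; first by have := zB s 0%N; rewrite prepend_same.
    move=> s' n; rewrite /tail_box; case: eqP => [->|/eqP ss'].
      by have := zB s n.+1; rewrite prepend_same.
    by have := zB s' n; rewrite prepend_other.
  move=> [aB zB] s' n; have [->|ss'] := eqVneq s' s.
    rewrite prepend_same; case: n => [//|n].
    by have := zB s n; rewrite /tail_box eqxx.
  by rewrite prepend_other//; have := zB s' n; rewrite /tail_box (negbTE ss').
rewrite product_measure1E//; last exact: measurable_box B'N.
transitivity (law s (B s 0%N) *
    (\prod_(s' < 4) \prod_(n < N) law s' (tail_box s B s' n))).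
  by congr (_ * _); exact: QE.
rewrite (bigD1 s)//= muleA [RHS](bigD1 s)//=; congr (_ * _).
  transitivity (\prod_(n < N.+1) law s (B s n)).
    rewrite big_ord_recl/=; congr (_ * _); apply: eq_bigr => n _.
    by rewrite /tail_box eqxx.
  by rewrite big_ord_recr/= BN// probability_setT mule1.
by apply: eq_bigr => s' /negbTE ss'; apply: eq_bigr => n _; rewrite /tail_box ss'.
Qed.

(** The first entry of a row is independent of the rest, which is distributed
    like the whole: this is the only independence used below. *)
Lemma integral_prepend s (g : stream_space -> \bar R) :
  measurable_fun setT g -> (forall z, 0 <= g z) ->
  \int[Q]_z g z = \int[law s]_a \int[Q]_z g (prepend s a z).
Proof.
move=> mg g0.
transitivity (\int[image_measure (law s \x Q) (measurable_prepend s)]_z g z).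
  apply: eq_measure_integral => A mA _.
  apply: (@box_law_unique law) => //.
    exact: (le_lt_trans (probability_le1 Q measurableT) (ltry _)).
  exact: box_law_prepend.
rewrite ge0_integral_pushforward//; last exact: measurable_prepend.
rewrite preimage_setT.
apply: (@fubini_tonelli1 _ _ _ _ _ (law s) Q (fun w => g (prepend s w.1 w.2))) => //.
exact: (measurableT_comp mg (measurable_prepend s)).
Qed.
End integral_prepend.

End streams.

(** * Counting events and restarting at a jump *)

Section counting.
Context {R : realType}.
Implicit Types (tau : nat -> R) (a b t : R).

Definition scons a tau : nat -> R := fun n => if n is n'.+1 then tau n' else a.

Lemma epoch_scons a tau n : epoch (scons a tau) n.+1 = a + epoch tau n.
Proof. by rewrite /epoch big_ord_recl. Qed.

Lemma event_countP tau t n : t < epoch tau n.+1 ->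
  (forall k, (k < n)%N -> epoch tau k.+1 <= t) -> event_count tau t = n.
Proof.
move=> tn kn; rewrite /event_count; case: pselect => [h|]; last by case; exists n.
case: ex_minnP => m /= tm mmin; apply/eqP; rewrite eqn_leq mmin//= leqNgt.
by apply/negP => /kn; rewrite leNgt tm.
Qed.

Lemma event_count0 tau t : (forall k, epoch tau k.+1 <= t) -> event_count tau t = 0%N.
Proof.
move=> kt; rewrite /event_count; case: pselect => // h; exfalso.
by case: h => n /=; rewrite ltNge kt.
Qed.

Variant event_count_spec tau t : nat -> Prop :=
| EventCountFinite n of t < epoch tau n.+1 &
    (forall k, (k < n)%N -> epoch tau k.+1 <= t) : event_count_spec tau t n
| EventCountExplosion of (forall k, epoch tau k.+1 <= t) :
    event_count_spec tau t 0%N.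

Lemma event_count_case tau t : event_count_spec tau t (event_count tau t).
Proof.
have [[n tn]|h] := pselect (exists n, [pred n | t < epoch tau n.+1] n).
  rewrite /event_count; case: pselect => [h|]; last by case; exists n.
  case: ex_minnP => m /= tm mmin; constructor => // k km.
  by rewrite leNgt; apply/negP => /mmin; rewrite leqNgt km.
have kt k : epoch tau k.+1 <= t.
  by rewrite leNgt; apply/negP => tk; apply: h; exists k.
by rewrite event_count0//; constructor.
Qed.

(** The count is right-continuous; after an explosion it keeps the default
    value. *)
Lemma event_count_right tau t : exists2 e : R, 0 < e &
  forall h, 0 <= h < e -> event_count tau (t + h) = event_count tau t.
Proof.
case: event_count_case => [n tn kn|kt].
  exists (epoch tau n.+1 - t); first by rewrite subr_gt0.
  move=> h /andP[h0 hn]; apply: event_countP; first by rewrite -ltrBrDl.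
  by move=> k /kn kt; rewrite (le_trans kt)// lerDl.
exists 1 => // h /andP[h0 _]; apply: event_count0 => k.
by rewrite (le_trans (kt k))// lerDl.
Qed.

(** The waiting time of the component that does not jump is only shortened by
    [a], so its count is shifted in time and not incremented. This includes the
    exploding sequences. *)
Lemma event_count_shift tau tau' a t :
  (forall n, epoch tau n.+1 = a + epoch tau' n.+1) ->
  event_count tau t = event_count tau' (t - a).
Proof.
move=> tauE; case: (event_count_case tau' (t - a)) => [n tn kn|kt].
  apply: event_countP; first by rewrite tauE -ltrBlDl.
  by move=> k /kn; rewrite tauE lerBrDl.
by apply: event_count0 => k; rewrite tauE -lerBrDl.
Qed.

Definition non_explosive tau := forall t, exists n, t < epoch tau n.+1.

Lemma event_count_scons a tau t : non_explosive tau -> a <= t ->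
  event_count (scons a tau) t = (event_count tau (t - a)).+1.
Proof.
move=> ne at_; case: (event_count_case tau (t - a)) => [n tn kn|kt]; last first.
  by have [n] := ne (t - a); rewrite ltNge kt.
apply: event_countP; first by rewrite epoch_scons -ltrBlDl.
case=> [_|k]; first by rewrite epoch_scons /epoch big_ord0 addr0.
by rewrite ltnS => /kn; rewrite epoch_scons lerBrDl.
Qed.

Lemma non_explosive_scons a tau : non_explosive (scons a tau) <-> non_explosive tau.
Proof.
split=> ne t.
  have [n] := ne (a + Num.max t 0); rewrite epoch_scons ltrD2l gt_max => /andP[tn].
  by case: n tn => [|n tn _]; [rewrite /epoch big_ord0 ltxx | exists n].
by have [n tn] := ne (t - a); exists n.+1; rewrite epoch_scons -ltrBlDl.
Qed.

End counting.

Section restart.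
Context {R : realType}.
Variables (c1 c2 r1 r2 : R).
Implicit Types (tau xi : nat -> R) (a b x u v t : R).

Let shift1 a (w : state) : @state R :=
  State (jumps1 w).+1 (jumps2 w) (a + time w) (pos1 w) (pos2 w).
Let shift2 a (w : state) : @state R :=
  State (jumps1 w) (jumps2 w).+1 (a + time w) (pos1 w) (pos2 w).

Let epoch_head a b tau n :
  epoch (scons b tau) n.+1 = a + epoch (scons (b - a) tau) n.+1.
Proof. by rewrite !epoch_scons addrA addrCA subrr addr0. Qed.

Let elapsed a x y : a + x - (a + y) = x - y.
Proof. by rewrite opprD addrACA subrr add0r. Qed.

Let next_state_shift1 tau1 tau2 xi1 xi2 a b x w :
  next_state c1 c2 r1 r2 (scons a tau1) (scons b tau2) (scons x xi1) xi2 (shift1 a w) =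
  shift1 a (next_state c1 c2 r1 r2 tau1 (scons (b - a) tau2) xi1 xi2 w).
Proof.
rewrite /next_state /= (epoch_scons a) (epoch_head a b) -addr_minr lerD2l elapsed.
by case: ifP.
Qed.

Let next_state_shift2 tau1 tau2 xi1 xi2 a b x w :
  next_state c1 c2 r1 r2 (scons a tau1) (scons b tau2) xi1 (scons x xi2) (shift2 b w) =
  shift2 b (next_state c1 c2 r1 r2 (scons (a - b) tau1) tau2 xi1 xi2 w).
Proof.
rewrite /next_state /= (epoch_scons b) (epoch_head b a) -addr_minr lerD2l elapsed.
by case: ifP.
Qed.

Let epoch1 a tau : epoch (scons a tau) 1 = a.
Proof. by rewrite epoch_scons /epoch big_ord0 addr0. Qed.

(** The state of the restarted process, with its clock and jump counter set back,
    is carried by the same recursion: the component that jumped loses its first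
    waiting time and its first jump, the other one keeps its residual waiting
    time [b - a]. Explosion of the first row must be excluded, because the
    default count 0 is not compatible with the increment of the counter. *)
Lemma reflected_jump1 tau1 tau2 xi1 xi2 a b x u v t :
  a <= b -> non_explosive tau1 -> a <= t ->
  let y := reflect_jump r1 (u + c1 * a - x) (v + c2 * a) in
  reflected c1 c2 r1 r2 (scons a tau1) (scons b tau2) (scons x xi1) xi2 u v t =
  reflected c1 c2 r1 r2 tau1 (scons (b - a) tau2) xi1 xi2 y.1 y.2 (t - a).
Proof.
move=> ab ne1 at_ y; rewrite /reflected event_count_scons//.
rewrite (event_count_shift t (epoch_head a b tau2)) addSn iterSr.
have -> : next_state c1 c2 r1 r2 (scons a tau1) (scons b tau2) (scons x xi1) xi2
    (State 0 0 0 u v) = shift1 a (State 0 0 0 y.1 y.2).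
  by rewrite /next_state/= !epoch1 ab min_l// subr0 /shift1/= addr0.
have it n w : iter n (next_state c1 c2 r1 r2 (scons a tau1) (scons b tau2)
      (scons x xi1) xi2) (shift1 a w) =
    shift1 a (iter n (next_state c1 c2 r1 r2 tau1 (scons (b - a) tau2) xi1 xi2) w).
  by elim: n => //= n ->; exact: next_state_shift1.
by rewrite it /shift1/= opprD addrA.
Qed.

Lemma reflected_jump2 tau1 tau2 xi1 xi2 a b x u v t :
  b < a -> non_explosive tau2 -> b <= t ->
  let y := reflect_jump r2 (v + c2 * b - x) (u + c1 * b) in
  reflected c1 c2 r1 r2 (scons a tau1) (scons b tau2) xi1 (scons x xi2) u v t =
  reflected c1 c2 r1 r2 (scons (a - b) tau1) tau2 xi1 xi2 y.2 y.1 (t - b).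
Proof.
move=> ba ne2 bt y; rewrite /reflected [in LHS](event_count_scons ne2 bt).
rewrite (event_count_shift t (epoch_head b a tau1)) addnS iterSr.
have -> : next_state c1 c2 r1 r2 (scons a tau1) (scons b tau2) xi1 (scons x xi2)
    (State 0 0 0 u v) = shift2 b (State 0 0 0 y.2 y.1).
  rewrite /next_state/= !epoch1 leNgt ba/= min_r ?ltW// subr0.
  by rewrite /shift2/= addr0.
have it n w : iter n (next_state c1 c2 r1 r2 (scons a tau1) (scons b tau2)
      xi1 (scons x xi2)) (shift2 b w) =
    shift2 b (iter n (next_state c1 c2 r1 r2 (scons (a - b) tau1) tau2 xi1 xi2) w).
  by elim: n => //= n ->; exact: next_state_shift2.
by rewrite it /shift2/= opprD addrA.
Qed.

Lemma reflected_right tau1 tau2 xi1 xi2 u v t : exists2 e : R, 0 < e &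
  forall h, 0 <= h < e ->
    reflected c1 c2 r1 r2 tau1 tau2 xi1 xi2 u v (t + h) =
    ((reflected c1 c2 r1 r2 tau1 tau2 xi1 xi2 u v t).1 + c1 * h,
     (reflected c1 c2 r1 r2 tau1 tau2 xi1 xi2 u v t).2 + c2 * h).
Proof.
have [e1 e10 E1] := event_count_right tau1 t.
have [e2 e20 E2] := event_count_right tau2 t.
exists (Num.min e1 e2); first by rewrite lt_min e10.
move=> h /andP[h0]; rewrite lt_min => /andP[he1 he2].
rewrite /reflected E1 ?h0// E2 ?h0//=.
by congr (_, _); ring.
Qed.

End restart.

(** * Escape along the first axis *)
Section escapes.
Context {R : realType}.
Implicit Types Y : R -> R * R.

Definition escapes Y : Prop :=
  (Y t).1 @[t --> +oo] --> +oo /\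
  ((Y t).2 / (Y t).1) @[t --> +oo] --> (0 : R).

Lemma near_pinftyP (P : R -> Prop) :
  (\forall t \near +oo, P t) <-> exists N : nat, forall t, N%:R < t -> P t.
Proof.
split=> [[M [_ MP]]|[N NP]].
  exists (Num.truncn `|M|).+1 => t Nt; apply: MP; apply: le_lt_trans Nt.
  by rewrite (le_trans (ler_norm M))// ltW// truncnS_gt.
by exists N%:R; split => //; exact: num_real.
Qed.

Lemma near_pinfty_shift (P : R * R -> Prop) Y Y' (a : R) :
  (forall t, a <= t -> Y t = Y' (t - a)) ->
  (\forall t \near +oo, P (Y t)) <-> (\forall t \near +oo, P (Y' t)).
Proof.
move=> YE; split=> [[M [_ MP]]|[M [_ MP]]].
  exists (Num.max (M - a) 0); split; first exact: num_real.
  move=> t; rewrite gt_max ltrBlDr => /andP[Mt t0].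
  by have := MP _ Mt; rewrite YE ?addrK// lerDr ltW.
exists (Num.max (M + a) a); split; first exact: num_real.
move=> t; rewrite gt_max -ltrBrDr => /andP[Mt at0].
by rewrite YE ?ltW//; exact: MP.
Qed.

(** Stated by inequalities that are large and linear in the position, the
    condition passes from rational to all times on a path that is linear to the
    right of each point. *)
Lemma escapesP Y : escapes Y <->
  forall m : nat, \forall t \near +oo,
    [/\ 0 <= (Y t).1 - m.+1%:R, 0 <= (Y t).1 - m.+1%:R * (Y t).2
      & 0 <= (Y t).1 + m.+1%:R * (Y t).2].
Proof.
split=> [[Yoo Y0] m|H].
  near=> t.
  have Y1 : m.+1%:R <= (Y t).1 by near: t; move/cvgryPge: Yoo; exact.
  have Ygt0 : 0 < (Y t).1 by exact: lt_le_trans Y1.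
  have : `|(Y t).2 / (Y t).1| <= m.+1%:R^-1.
    near: t; move/cvgr0Pnorm_le: Y0; apply.
    by rewrite invr_gt0.
  rewrite normrM normfV (gtr0_norm Ygt0) ler_pdivrMr// ler_pdivlMl// => h.
  split; rewrite ?subr_ge0//.
    by apply: le_trans h; rewrite ler_wpM2l// ler_norm.
  rewrite -lerBlDr sub0r -mulrN; apply: le_trans h.
  by rewrite ler_wpM2l// -normrN ler_norm.
split.
  apply/cvgryPge => A; near=> t.
  have [Y1 _ _] : [/\ 0 <= (Y t).1 - (Num.truncn `|A|).+1%:R,
      0 <= (Y t).1 - (Num.truncn `|A|).+1%:R * (Y t).2
    & 0 <= (Y t).1 + (Num.truncn `|A|).+1%:R * (Y t).2] by near: t; exact: H.
  rewrite (le_trans (ler_norm A))// (le_trans (ltW (truncnS_gt _)))//.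
  by rewrite -subr_ge0.
apply/cvgr0Pnorm_le => e e0; near=> t.
have [] : [/\ 0 <= (Y t).1 - (Num.truncn e^-1).+1%:R,
    0 <= (Y t).1 - (Num.truncn e^-1).+1%:R * (Y t).2
  & 0 <= (Y t).1 + (Num.truncn e^-1).+1%:R * (Y t).2] by near: t; exact: H.
set m := (Num.truncn _).+1; rewrite !subr_ge0 => Y1 Y2 Y3.
have Ygt0 : 0 < (Y t).1 by exact: lt_le_trans Y1.
have mY : m%:R * `|(Y t).2| <= (Y t).1.
  have [y0|y0] := leP 0 (Y t).2; first by rewrite ger0_norm.
  by rewrite ltr0_norm// mulrN lerNl -subr_ge0 opprK addrC.
rewrite normrM normfV (gtr0_norm Ygt0) ler_pdivrMr// -ler_pdivrMl//.
apply: le_trans mY; rewrite ler_wpM2r// ltW//.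
exact: truncnS_gt.
Unshelve. all: by end_near. Qed.

Lemma escapes_shift Y Y' (a : R) : (forall t, a <= t -> Y t = Y' (t - a)) ->
  escapes Y <-> escapes Y'.
Proof.
move=> YE; rewrite !escapesP; split=> H m.
  by rewrite -(near_pinfty_shift (fun y => [/\ 0 <= y.1 - m.+1%:R,
    0 <= y.1 - m.+1%:R * y.2 & 0 <= y.1 + m.+1%:R * y.2]) YE).
by rewrite (near_pinfty_shift (fun y => [/\ 0 <= y.1 - m.+1%:R,
    0 <= y.1 - m.+1%:R * y.2 & 0 <= y.1 + m.+1%:R * y.2]) YE).
Qed.

(** A negative value at [t] persists on an interval to the right of [t], which
    contains a rational. *)
Lemma ge0_from_rat (f : R -> R) (N : R) :
  (forall t, exists e c : R, 0 < e /\ forall h, 0 <= h < e -> f (t + h) = f t + c * h) ->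
  (forall q : rat, N < ratr q -> 0 <= f (ratr q)) -> forall t, N < t -> 0 <= f t.
Proof.
move=> fR fQ t Nt; rewrite leNgt; apply/negP => ft0.
have [e [c [e0 E]]] := fR t.
pose d := Num.min e (- f t / (`|c| + 1)).
have c1 : 0 < `|c| + 1 by rewrite ltr_wpDl.
have d0 : 0 < d by rewrite lt_min e0 divr_gt0// oppr_gt0.
have [q] := @rat_in_itvoo R t (t + d) (ltac:(by rewrite ltrDl)).
rewrite in_itv/= => /andP[tq qd].
have := fQ q (lt_trans Nt tq); rewrite leNgt => /negP; apply.
have h0 : 0 <= ratr q - t by rewrite subr_ge0 ltW.
have hd : ratr q - t < d by rewrite ltrBlDl.
rewrite -(subrK t (ratr q)) addrC E; last first.
  by rewrite h0 (lt_le_trans hd)// ge_min lexx.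
rewrite -ltrBrDl sub0r; apply: (@le_lt_trans _ _ (`|c| * (ratr q - t))).
  by rewrite ler_wpM2r// ler_norm.
apply: (@le_lt_trans _ _ ((`|c| + 1) * (ratr q - t))).
  by rewrite ler_wpM2r// lerDl.
rewrite -ltr_pdivlMl// mulrC (lt_le_trans hd)//.
by rewrite ge_min lexx orbT.
Qed.

Section measurability.
Context d (X : measurableType d) (Y : X -> R -> R * R) (c1 c2 : R).
Hypothesis mY1 : forall t, measurable_fun setT (fun x => (Y x t).1).
Hypothesis mY2 : forall t, measurable_fun setT (fun x => (Y x t).2).
Hypothesis Yright : forall x t, exists2 e : R, 0 < e & forall h, 0 <= h < e ->
  Y x (t + h) = ((Y x t).1 + c1 * h, (Y x t).2 + c2 * h).

Let good m t x := [/\ 0 <= (Y x t).1 - m.+1%:R, 0 <= (Y x t).1 - m.+1%:R * (Y x t).2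
      & 0 <= (Y x t).1 + m.+1%:R * (Y x t).2].

Let good_from_rat m x (N : R) :
  (forall q : rat, N < ratr q -> good m (ratr q) x) ->
  forall t, N < t -> good m t x.
Proof.
move=> gq t Nt; split.
- apply: (@ge0_from_rat (fun t => (Y x t).1 - m.+1%:R) N) => //.
    move=> s; have [e e0 E] := Yright x s; exists e, c1; split => // h /E -> /=.
    by ring.
  by move=> q /gq[].
- apply: (@ge0_from_rat (fun t => (Y x t).1 - m.+1%:R * (Y x t).2) N) => //.
    move=> s; have [e e0 E] := Yright x s.
    exists e, (c1 - m.+1%:R * c2); split => // h /E -> /=.
    by ring.
  by move=> q /gq[].
- apply: (@ge0_from_rat (fun t => (Y x t).1 + m.+1%:R * (Y x t).2) N) => //.
    move=> s; have [e e0 E] := Yright x s.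
    exists e, (c1 + m.+1%:R * c2); split => // h /E -> /=.
    by ring.
  by move=> q /gq[].
Qed.

Let measurable_good m t : measurable [set x | good m t x].
Proof.
have mge (f : X -> R) : measurable_fun setT f -> measurable [set x | 0 <= f x].
  by move=> mf; have := mf measurableT _ (measurable_itv `[0, +oo[);
    rewrite setTI; congr measurable; apply/seteqP; split=> x /=; rewrite in_itv/= andbT.
have -> : [set x | good m t x] = [set x | 0 <= (Y x t).1 - m.+1%:R] `&`
  [set x | 0 <= (Y x t).1 - m.+1%:R * (Y x t).2] `&`
  [set x | 0 <= (Y x t).1 + m.+1%:R * (Y x t).2].
  by apply/seteqP; split=> x; [move=> [? ? ?]|move=> [[? ?] ?]].
have mY1t := mY1 t; have mY2t := mY2 t.
apply: measurableI; [apply: measurableI|]; apply: mge.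
- exact: measurable_funB.
- by apply: measurable_funB => //; exact: measurable_funM.
- by apply: measurable_funD => //; exact: measurable_funM.
Qed.

(** Rational times decide the event, which leaves countable unions and
    intersections. *)
Lemma measurable_escapes : measurable [set x | escapes (Y x)].
Proof.
have -> : [set x | escapes (Y x)] = \bigcap_m \bigcup_(N : nat)
    ~` \bigcup_(q : rat) [set x | N%:R < ratr q :> R /\ ~ good m (ratr q) x].
  apply/seteqP; split=> x /=.
    move=> /escapesP H m _; have /near_pinftyP[N NP] := H m.
    by exists N => // -[q _ [Nq]]; apply; exact: NP.
  move=> H; apply/escapesP => m; apply/near_pinftyP.
  have [N _ NH] := H m Logic.I; exists N; apply: good_from_rat => q Nq.
  by apply: contrapT => ng; apply: NH; exists q.
apply: bigcapT_measurable => m; apply: bigcupT_measurable => N.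
apply: measurableC; apply: bigcupT_measurable_rat => q.
have [Nq|Nq] := boolP (N%:R < ratr q :> R); last first.
  by rewrite (_ : [set _ | _] = set0)//; apply/seteqP; split => // x [].
rewrite (_ : [set _ | _] = ~` [set x | good m (ratr q) x]).
  exact: measurableC.
by apply/seteqP; split=> x /=; [case=> _ ng; exact: ng|move=> ng; split => //].
Qed.
End measurability.
End escapes.

(** * Measurability of the reflected process *)

Section random_index.
Context d (X : measurableType d).

Lemma measurable_fun_nat (N : X -> nat) :
  (forall n, measurable (N @^-1` [set n])) -> measurable_fun setT N.
Proof.
move=> mN _ B _; rewrite setTI.
rewrite (_ : N @^-1` B = \bigcup_(n in B) (N @^-1` [set n])).
  exact: bigcup_measurable.
by apply/seteqP; split=> x /=; [exists (N x)|case=> n Bn Nn; rewrite Nn].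
Qed.

Lemma measurable_random_index d' (T : measurableType d') (N : X -> nat)
    (f : nat -> X -> T) :
  measurable_fun setT N -> (forall n, measurable_fun setT (f n)) ->
  measurable_fun setT (fun x => f (N x) x).
Proof.
move=> mN mf _ B mB; rewrite setTI.
rewrite (_ : _ @^-1` B = \bigcup_n (N @^-1` [set n] `&` f n @^-1` B)).
  apply: bigcupT_measurable => n; apply: measurableI.
    by rewrite -[X in measurable X]setTI; exact: mN.
  by rewrite -[X in measurable X]setTI; exact: mf.
apply/seteqP; split=> x /=; first by exists (N x).
by case=> n _ [/= Nn fB]; rewrite Nn.
Qed.

Lemma measurable_fun_succ (N : X -> nat) :
  measurable_fun setT N -> measurable_fun setT (fun x => (N x).+1).
Proof.
by move=> mN; apply: (@measurableT_comp _ _ _ _ _ _ S).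
Qed.
End random_index.

Section random_path.
Context {R : realType} d (X : measurableType d).
Variables (c1 c2 r1 r2 : R) (tau1 tau2 xi1 xi2 : X -> nat -> R) (u v : X -> R).
Hypotheses (mtau1 : forall n, measurable_fun setT (fun x => tau1 x n))
  (mtau2 : forall n, measurable_fun setT (fun x => tau2 x n))
  (mxi1 : forall n, measurable_fun setT (fun x => xi1 x n))
  (mxi2 : forall n, measurable_fun setT (fun x => xi2 x n))
  (mu : measurable_fun setT u) (mv : measurable_fun setT v).

Lemma measurable_epoch (tau : X -> nat -> R) n :
  (forall n, measurable_fun setT (fun x => tau x n)) ->
  measurable_fun setT (fun x => epoch (tau x) n).
Proof. by move=> mtau; rewrite /epoch; apply: measurable_sum. Qed.

Lemma measurable_event_count (tau : X -> nat -> R) t :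
  (forall n, measurable_fun setT (fun x => tau x n)) ->
  measurable_fun setT (fun x => event_count (tau x) t).
Proof.
move=> mtau; apply: measurable_fun_nat => n.
have mlt k : measurable [set x | t < epoch (tau x) k].
  have := measurable_epoch k mtau measurableT (measurable_itv `]t, +oo[).
  by rewrite setTI; congr measurable; apply/seteqP; split=> x /=; rewrite in_itv/= andbT.
have mge k : measurable [set x | epoch (tau x) k <= t].
  rewrite (_ : [set _ | _] = ~` [set x | t < epoch (tau x) k]).
    exact: measurableC.
  by apply/seteqP; split=> x /=; [move=> h; rewrite ltNge h|rewrite leNgt => /negP].
pose F := [set x | t < epoch (tau x) n.+1] `&`
  \bigcap_k [set x | (k < n)%N -> epoch (tau x) k.+1 <= t].
(* Exploding sequences are counted as 0. *)
pose E := if n is 0%N then \bigcap_k [set x | epoch (tau x) k.+1 <= t] else set0.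
rewrite (_ : _ @^-1` _ = F `|` E).
  apply: measurableU.
    apply: measurableI => //; apply: bigcapT_measurable => k.
    have [kn|kn] := boolP (k < n)%N.
      rewrite (_ : [set _ | _] = [set x | epoch (tau x) k.+1 <= t])//.
      by apply/seteqP; split=> x /=; [exact|move=> + _].
    rewrite (_ : [set _ | _] = setT)//.
    by apply/seteqP; split=> x.
  by rewrite /E; case: n {F E} => //; exact: bigcapT_measurable.
apply/seteqP; split=> x /=.
  case: event_count_case => [m tm km mn|kt n0].
    by left; split; [|move=> k _]; rewrite /= -mn//; exact: km.
  by right; rewrite /E -n0 => k _; exact: kt.
move=> [[tn kn]|]; first by apply: event_countP => // k; exact: kn.
rewrite /E; case: n {F E} => //= h; apply: event_count0 => k; exact: h.
Qed.

Let measurable_state (w : X -> @state R) :=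
  [/\ measurable_fun setT (fun x => jumps1 (w x)),
      measurable_fun setT (fun x => jumps2 (w x)),
      measurable_fun setT (fun x => time (w x)),
      measurable_fun setT (fun x => pos1 (w x))
    & measurable_fun setT (fun x => pos2 (w x))].

Let measurable_state_if (b : X -> bool) (w w' : X -> @state R) :
  measurable_fun setT b -> measurable_state w -> measurable_state w' ->
  measurable_state (fun x => if b x then w x else w' x).
Proof.
move=> mb [m1 m2 m3 m4 m5] [m1' m2' m3' m4' m5'].
split.
- rewrite (_ : (fun x => _) = fun x => if b x then jumps1 (w x) else jumps1 (w' x)).
    exact: measurable_fun_ifT.
  by apply/funext => x; case: ifP.
- rewrite (_ : (fun x => _) = fun x => if b x then jumps2 (w x) else jumps2 (w' x)).
    exact: measurable_fun_ifT.
  by apply/funext => x; case: ifP.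
- rewrite (_ : (fun x => _) = fun x => if b x then time (w x) else time (w' x)).
    exact: measurable_fun_ifT.
  by apply/funext => x; case: ifP.
- rewrite (_ : (fun x => _) = fun x => if b x then pos1 (w x) else pos1 (w' x)).
    exact: measurable_fun_ifT.
  by apply/funext => x; case: ifP.
- rewrite (_ : (fun x => _) = fun x => if b x then pos2 (w x) else pos2 (w' x)).
    exact: measurable_fun_ifT.
  by apply/funext => x; case: ifP.
Qed.

Lemma measurable_reflect_jump r (f g : X -> R) :
  measurable_fun setT f -> measurable_fun setT g ->
  measurable_fun setT (fun x => reflect_jump r (f x) (g x)).
Proof.
move=> mf mg; apply: measurable_fun_ifT; first exact: measurable_fun_ler.
  exact: measurable_fun_pair.
apply: measurable_fun_pair; first exact: measurable_cst.
apply: measurable_funD => //; apply: measurable_funM => //.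
exact: (measurableT_comp (@normr_measurable _ _) mf).
Qed.

Let measurable_next_state w : measurable_state w ->
  measurable_state (fun x =>
    next_state c1 c2 r1 r2 (tau1 x) (tau2 x) (xi1 x) (xi2 x) (w x)).
Proof.
move=> [m1 m2 m3 m4 m5].
have mS1 : measurable_fun setT (fun x => epoch (tau1 x) (jumps1 (w x)).+1).
  apply: (measurable_random_index (f := fun n x => epoch (tau1 x) n)).
    exact: measurable_fun_succ.
  by move=> n; exact: measurable_epoch.
have mS2 : measurable_fun setT (fun x => epoch (tau2 x) (jumps2 (w x)).+1).
  apply: (measurable_random_index (f := fun n x => epoch (tau2 x) n)).
    exact: measurable_fun_succ.
  by move=> n; exact: measurable_epoch.
have mS := measurable_minr mS1 mS2.
have mz c (p : X -> R) : measurable_fun setT p -> measurable_fun setT (fun x => p x +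
    c * (Num.min (epoch (tau1 x) (jumps1 (w x)).+1)
          (epoch (tau2 x) (jumps2 (w x)).+1) - time (w x))).
  move=> mp; apply: measurable_funD => //; apply: measurable_funM => //.
  exact: measurable_funB.
have mx1 : measurable_fun setT (fun x => xi1 x (jumps1 (w x))).
  exact: (measurable_random_index (f := fun n x => xi1 x n)).
have mx2 : measurable_fun setT (fun x => xi2 x (jumps2 (w x))).
  exact: (measurable_random_index (f := fun n x => xi2 x n)).
apply: measurable_state_if; first exact: measurable_fun_ler.
  have my := measurable_reflect_jump r1 (measurable_funB (mz c1 _ m4) mx1) (mz c2 _ m5).
  split => //=; first exact: measurable_fun_succ.
    exact: (measurable_pr1 my).
  exact: (measurable_pr2 my).
have my := measurable_reflect_jump r2 (measurable_funB (mz c2 _ m5) mx2) (mz c1 _ m4).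
split => //=; first exact: measurable_fun_succ.
  exact: (measurable_pr2 my).
exact: (measurable_pr1 my).
Qed.

Let measurable_iter n : measurable_state (fun x =>
  iter n (next_state c1 c2 r1 r2 (tau1 x) (tau2 x) (xi1 x) (xi2 x))
    (State 0 0 0 (u x) (v x))).
Proof.
by elim: n => [|n IHn] /=; [split|exact: measurable_next_state].
Qed.

Lemma measurable_reflected t : measurable_fun setT (fun x =>
  reflected c1 c2 r1 r2 (tau1 x) (tau2 x) (xi1 x) (xi2 x) (u x) (v x) t).
Proof.
pose N x := (event_count (tau1 x) t + event_count (tau2 x) t)%N.
have mN : measurable_fun setT N.
  by apply: measurable_fun_addn; exact: measurable_event_count.
pose W n x := iter n (next_state c1 c2 r1 r2 (tau1 x) (tau2 x) (xi1 x) (xi2 x))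
    (State 0 0 0 (u x) (v x)).
apply: measurable_fun_pair => /=.
  apply: (measurable_random_index
    (f := fun n x => pos1 (W n x) + c1 * (t - time (W n x)))) => //.
  move=> n; have [_ _ m3 m4 m5] := measurable_iter n; rewrite /W; meas.
apply: (measurable_random_index (f := fun n x => pos2 (W n x) + c2 * (t - time (W n x)))) => //.
move=> n; have [_ _ m3 m4 m5] := measurable_iter n; rewrite /W; meas.
Qed.

Lemma measurable_escapes_reflected : measurable [set x |
  escapes (reflected c1 c2 r1 r2 (tau1 x) (tau2 x) (xi1 x) (xi2 x) (u x) (v x))].
Proof.
apply: (@measurable_escapes _ _ _ _ c1 c2).
- by move=> t; exact: (measurable_pr1 (measurable_reflected t)).
- by move=> t; exact: (measurable_pr2 (measurable_reflected t)).
- by move=> x t; exact: reflected_right.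
Qed.
End random_path.

(** * The exponential law *)

Section density.
Local Open Scope ereal_scope.
Context d (T : measurableType d) (R : realType).
Variables (m nu : {measure set T -> \bar R}) (w : T -> \bar R).
Hypotheses (w0 : forall x, 0 <= w x) (mw : measurable_fun setT w).
Hypothesis wfin : forall x, w x \is a fin_num.
Hypothesis nuE : forall A, measurable A -> nu A = \int[m]_(x in A) w x.

Import HBNNSimple.

Let integral_density_nnsfun (h : {nnsfun T >-> R}) :
  \int[nu]_x (h x)%:E = \int[m]_x (w x * (h x)%:E).
Proof.
have hE x : (h x)%:E = \sum_(r \in range h) (r * \1_(h @^-1` [set r]) x)%:E.
  by rewrite fsumEFin// -fimfunE.
under eq_integral do rewrite hE.
rewrite ge0_integral_fsum//; last 2 first.
- by move=> r; exact/measurable_EFinP/measurable_funM.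
- by move=> r x _; rewrite nnfun_muleindic_ge0.
have -> : \int[m]_x (w x * (h x)%:E) =
    \int[m]_x \sum_(r \in range h) (w x * (r * \1_(h @^-1` [set r]) x)%:E).
  apply: eq_integral => x _; rewrite hE ge0_mule_fsumr// => r.
  by rewrite nnfun_muleindic_ge0.
rewrite ge0_integral_fsum//; last 2 first.
- move=> r; apply: emeasurable_funM => //.
  exact/measurable_EFinP/measurable_funM.
- by move=> r x _; rewrite mule_ge0// nnfun_muleindic_ge0.
apply: eq_fsbigr => r; rewrite inE => -[y _ hy].
have r0 : (0 <= r)%R by rewrite -hy.
rewrite integralZl_indic_nnsfun// integral_indic// setIT nuE//.
rewrite integral_mkcond -ge0_integralZl//; last 2 first.
- by apply/(measurable_restrictT _ _).1 => //; exact: measurable_funTS.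
- by move=> x _; exact: erestrict_ge0.
apply: eq_integral => x _; rewrite EFinM muleCA patchE indicE.
by case: ifPn => _; rewrite ?mule1 ?mule0.
Qed.

(** By definition for indicators, by linearity for simple functions, and by
    monotone convergence in general. *)
Lemma integral_density (f : T -> \bar R) :
  measurable_fun setT f -> (forall x, 0 <= f x) ->
  \int[nu]_x f x = \int[m]_x (w x * f x).
Proof.
move=> mf f0; pose f_ := nnsfun_approx measurableT mf.
transitivity (limn (fun n => \int[nu]_x (f_ n x)%:E)).
  rewrite -monotone_convergence//.
  - apply: eq_integral => y _; apply/esym/cvg_lim => //.
    exact: cvg_nnsfun_approx.
  - by move=> n; exact/measurable_EFinP/measurable_funP.
  - by move=> n y _; rewrite lee_fin.
  - by move=> y _ k n kn; rewrite lee_fin; exact/lefP/nd_nnsfun_approx.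
rewrite (_ : (fun n => _) = fun n => \int[m]_x (w x * (f_ n x)%:E)); last first.
  by apply/funext => n; exact: integral_density_nnsfun.
rewrite -monotone_convergence//.
- apply: eq_integral => y _; apply/cvg_lim => //.
  by apply: cvgeZl => //; exact: cvg_nnsfun_approx.
- move=> n; apply: emeasurable_funM => //.
  exact/measurable_EFinP/measurable_funP.
- by move=> n y _; rewrite mule_ge0 ?lee_fin.
- move=> y _ k n kn; rewrite lee_wpmul2l// lee_fin.
  exact/lefP/nd_nnsfun_approx.
Qed.
End density.

Section exponential_law.
Local Open Scope ereal_scope.
Context {R : realType}.
Local Notation leb := (@lebesgue_measure R).
Variables (rate : R) (mu : probability R R).
Hypothesis rate_gt0 : (0 < rate)%R.
Hypothesis muE : forall B, measurable B -> mu B = exponential_prob rate B.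

Lemma integral_exponential (f : R -> \bar R) :
  measurable_fun setT f -> (forall x, 0 <= f x) ->
  \int[mu]_x f x = \intp_x ((rate * expR (- (rate * x)))%:E * f x).
Proof.
move=> mf f0.
have mpdf := measurable_exponential_pdf rate.
(* [mu] and Lebesgue measure live on two names of the same measurable space. *)
have mid : measurable_fun setT (fun x : R => x : measurableTypeR R).
  by move=> _ A mA; rewrite setTI; exact: mA.
have -> : \int[mu]_x f x = \int[image_measure mu mid]_x f x.
  by rewrite ge0_integral_pushforward.
rewrite (@integral_density _ _ _ leb (image_measure mu mid) (EFin \o exponential_pdf rate))//.
- rewrite [RHS]integral_mkcond; apply: eq_integral => x _.
  rewrite /= /exponential_pdf !patchE; case: ifPn => _; last by rewrite mul0e.
  by rewrite mulNr.
- by move=> x; rewrite lee_fin exponential_pdf_ge0// ltW.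
- exact/measurable_EFinP.
Qed.

(** The density at [x] is [exp (- rate * a)] times the density at [x - a].
    Ties between waiting times form a null set, so the strict and the large
    inequality give the same value; both occur, since a tie counts as a jump of
    the first component. *)
Lemma integral_exponential_memoryless (strict : bool) (a : R)
    (f : R -> \bar R) : (0 <= a)%R ->
  measurable_fun setT f -> (forall x, 0 <= f x) ->
  \int[mu]_x (eind (if strict then a < x else a <= x)%R * f (x - a)%R) =
  (expR (- (rate * a)))%:E * \int[mu]_x f x.
Proof.
move=> a0 mf f0.
have mrate : measurable_fun setT (fun x : R => (rate * expR (- (rate * x)))%:E) by meas.
have mind : measurable_fun setT (fun x : R =>
    eind (if strict then a < x else a <= x)%R : \bar R).
  by case: strict; meas.
rewrite integral_exponential//; last 2 first.
- by apply: emeasurable_funM => //; meas.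
- by nneg.
transitivity (\intp_x (eind (a <= x)%R * ((rate * expR (- (rate * x)))%:E * f (x - a)%R))).
  apply: (@eq_intp_but _ _ _ a).
  - by apply: emeasurable_funM => //; apply: emeasurable_funM => //; meas.
  - by meas.
  - move=> x _ xa; rewrite muleCA.
    have -> // : (if strict then a < x else a <= x)%R = (a <= x)%R.
    by case: (strict); rewrite // lt_def xa.
rewrite -(@intp_shift _ (fun x => (rate * expR (- (rate * x)))%:E * f (x - a)%R))//;
  last 2 first.
- by meas.
- by nneg.
rewrite integral_exponential// -intpZl; last first.
- by nneg.
- by meas.
- by nneg.
apply: eq_intp => x _; rewrite addrK muleA -EFinM mulrCA -expRD.
by congr ((rate * expR _)%:E * _); ring.
Qed.
End exponential_law.

(** * Absence of explosion *)

Section random_streams.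
Local Open Scope ereal_scope.
Context {R : realType}.
Variables (rate : 'I_4 -> R) (law : 'I_4 -> probability R R).
Variable Q : probability (@stream_space R) R.
Hypothesis rate_gt0 : forall s, (0 < rate s)%R.
Hypothesis lawE : forall s B, measurable B -> law s B = exponential_prob (rate s) B.
Hypothesis QE : box_law law Q.

Lemma measurable_row_epoch s n :
  measurable_fun setT (fun z : stream_space => epoch (z s) n : R).
Proof. by apply: measurable_epoch => k; exact: measurable_coordinate. Qed.

Lemma measurable_non_explosive s :
  measurable [set z : @stream_space R | non_explosive (z s)].
Proof.
rewrite (_ : [set _ | _] = \bigcap_(m : nat) \bigcup_n
    ((fun z : stream_space => epoch (z s) n.+1) @^-1` `]m%:R, +oo[)).
  apply: bigcapT_measurable => m; apply: bigcupT_measurable => n.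
  by rewrite -[X in measurable X]setTI; exact: measurable_row_epoch.
apply/seteqP; split=> z /=.
  by move=> ne m _; have [n mn] := ne m%:R; exists n => //=; rewrite in_itv/= andbT.
move=> ne t; have [n _ /=] := ne (Num.truncn `|t|).+1 Logic.I.
rewrite in_itv/= andbT => tn; exists n; apply: le_lt_trans tn.
by rewrite (le_trans (ler_norm t))// ltW// truncnS_gt.
Qed.

Let theta s : R := (rate s / (rate s + 1))%R.

(** The number [theta s] is the Laplace transform at 1 of the exponential law of
    rate [rate s]. *)
Lemma integral_expR_epoch s n :
  \int[Q]_z (expR (- epoch (z s) n))%:E = (theta s ^+ n)%:E.
Proof.
elim: n => [|n IHn].
  under eq_integral do rewrite /epoch big_ord0 oppr0 expR0.
  by rewrite integral_cst//= mul1e probability_setT.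
have me k : measurable_fun setT (fun z : stream_space => (expR (- epoch (z s) k))%:E : \bar R).
  apply/measurable_EFinP; apply: (measurableT_comp (@measurable_expR R)).
  by apply: measurable_funN; exact: measurable_row_epoch.
rewrite (integral_prepend QE s)//.
transitivity (\int[law s]_a ((expR (- a))%:E * (theta s ^+ n)%:E)).
  apply: eq_integral => a _; rewrite -IHn -ge0_integralZl//.
  apply: eq_integral => z _; rewrite -EFinM -expRD -opprD.
  by congr ((expR (- _))%:E); rewrite /epoch big_ord_recl prepend_same; congr (_ + _)%R;
    apply: eq_bigr => i _; rewrite prepend_same.
rewrite ge0_integralZr//; last 2 first.
- by meas.
- by rewrite lee_fin exprn_ge0// divr_ge0// ltW// addr_gt0.
rewrite (integral_exponential (rate_gt0 s) (lawE s))//; last by meas.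
rewrite (eq_intp (g := fun x => (rate s * expR (- ((rate s + 1) * x)))%:E)).
  rewrite intp_expR_scaled//; last by rewrite addr_gt0.
    by rewrite -EFinM exprS.
  exact: ltW.
by move=> x _; rewrite -EFinM -mulrA -expRD; congr (_ * expR _)%:E; ring.
Qed.

Lemma measurable_bounded_epochs s (M : R) :
  measurable [set z : @stream_space R | forall n, (epoch (z s) n <= M)%R].
Proof.
rewrite (_ : [set _ | _] = \bigcap_n
    ((fun z : stream_space => epoch (z s) n) @^-1` `]-oo, M])).
  apply: bigcapT_measurable => n.
  by rewrite -[X in measurable X]setTI; exact: measurable_row_epoch.
apply/seteqP; split=> z h n; first by move=> _; rewrite /= in_itv/=; exact: h.
by have := h n Logic.I; rewrite /= in_itv.
Qed.

(** On this event [exp (M - epoch n)] is at least 1, and its mean tends to 0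
    geometrically. *)
Lemma bounded_epochs_null s (M : R) :
  Q [set z | forall n, (epoch (z s) n <= M)%R] = 0.
Proof.
pose A : set (@stream_space R) := [set z | forall n, (epoch (z s) n <= M)%R].
rewrite -[X in Q X]/A.
have mA : measurable A by exact: measurable_bounded_epochs.
have QA n : Q A <= (expR M * theta s ^+ n)%:E.
  rewrite -[A]setIT -integral_indic// EFinM -integral_expR_epoch -ge0_integralZl//; last first.
    apply/measurable_EFinP; apply: (measurableT_comp (@measurable_expR R)).
    by apply: measurable_funN; exact: measurable_row_epoch.
  apply: ge0_le_integral => //.
  - exact/measurable_EFinP.
  - apply: emeasurable_funM => //.
    apply/measurable_EFinP; apply: (measurableT_comp (@measurable_expR R)).
    by apply: measurable_funN; exact: measurable_row_epoch.
  move=> z _; rewrite -EFinM lee_fin indicE; case: (boolP (z \in A)) => [|_]; last first.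
    by rewrite mulr_ge0// expR_ge0.
  rewrite inE => zA; rewrite -expRD /= -(@expR0 R) ler_expR subr_ge0; exact: zA.
apply/eqP; rewrite eq_le measure_ge0 andbT.
have Qfin : Q A \is a fin_num by exact: fin_num_measure.
rewrite -(fineK Qfin) lee_fin.
have th : (expR M * theta s ^+ n)%R @[n --> \oo] --> (expR M * 0)%R.
  apply: cvgMr; apply: cvg_expr.
  rewrite ger0_norm ?divr_ge0 ?ltW ?addr_gt0//.
  by rewrite ltr_pdivrMr ?addr_gt0// mul1r ltrDl.
rewrite mulr0 in th.
rewrite -(cvg_lim _ th)//; apply: limr_ge; first by apply/cvg_ex; exists 0%R.
by apply: nearW => n; rewrite -lee_fin fineK.
Qed.

Lemma non_explosive_ae s : Q [set z | ~ non_explosive (z s)] = 0.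
Proof.
apply: (@measure_negligible _ _ _ Q).
  have -> : [set z | ~ non_explosive (z s)] = ~` [set z : stream_space | non_explosive (z s)] by [].
  by apply: measurableC; exact: measurable_non_explosive.
apply: (negligibleS (A := \bigcup_(m : nat)
    [set z : stream_space | forall n, (epoch (z s) n <= m%:R)%R])); last first.
  apply: negligible_bigcup => m.
  exists [set z : stream_space | forall n, (epoch (z s) n <= m%:R)%R].
  split => //; last exact: bounded_epochs_null.
  exact: measurable_bounded_epochs.
move=> z /= zne.
have [t tz] : exists t, forall n, (epoch (z s) n.+1 <= t)%R.
  apply: contrapT => h; apply: zne => t; apply: contrapT => h'; apply: h.
  by exists t => n; rewrite leNgt; apply/negP => tn; apply: h'; exists n.
exists (Num.truncn `|t|).+1 => // -[|n].
  by rewrite /epoch big_ord0.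
rewrite (le_trans (tz n))// (le_trans (ler_norm t))// ltW//.
exact: truncnS_gt.
Qed.
End random_streams.

(** * The first jump *)

Section first_jump.
Local Open Scope ereal_scope.
Context {R : realType}.
Variables (rate : 'I_4 -> R) (law : 'I_4 -> probability R R).
Variable Q : probability (@stream_space R) R.
Hypothesis rate_gt0 : forall s, (0 < rate s)%R.
Hypothesis lawE : forall s B, measurable B -> law s B = exponential_prob (rate s) B.
Hypothesis QE : box_law law Q.

(** Rows [i] and [j] hold the waiting times of the component that jumps first
    and of the other one; row [k] holds the jump sizes of the former. Pulling out
    the leading entries [a], [x], [b] of the three rows leaves an array of the
    same law. The lack of memory replaces [b] on [a <= b] by [a] plus a fresh
    waiting time, at the cost of the factor [exp (- rate j * a)]; putting this
    fresh entry back in front of row [j] again leaves the law unchanged, so that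
    what remains is the probability of the restarted event. *)
Lemma first_jump_part (i j k : 'I_4) (strict : bool)
    (E : set (@stream_space R)) (E' : R -> R -> set (@stream_space R)) :
  i != j -> k != i -> k != j ->
  measurable E -> (forall a x, measurable (E' a x)) ->
  (forall a, measurable_fun setT (fun x => Q (E' a x))) ->
  (forall a b x z, (if strict then a < b else a <= b)%R ->
    E (prepend i a (prepend k x (prepend j b z))) <-> E' a x (prepend j (b - a) z)) ->
  \int[Q]_z (eind (if strict then z i 0%N < z j 0%N else z i 0%N <= z j 0%N)%R
     * (\1_E z)%:E) =
  \intp_a ((rate i * expR (- ((rate i + rate j) * a)))%:E *
    \int[law k]_x Q (E' a x)).
Proof.
move=> ij ki kj mE mE' mQE' EE'.
set g := fun z => _ * _.
have g0 z : 0 <= g z by rewrite mule_ge0 ?eind_ge0// lee_fin.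
have mg : measurable_fun setT g.
  apply: emeasurable_funM; last exact/measurable_EFinP.
  have mi := @measurable_coordinate R i 0; have mj := @measurable_coordinate R j 0.
  by apply: measurable_eind; case: (strict);
    [exact: measurable_fun_ltr | exact: measurable_fun_ler].
have mgi s a : measurable_fun setT (fun z : stream_space => g (prepend s a z)).
  exact: (measurableT_comp mg (measurable_prepend2 s a)).
have gE a b x z : g (prepend i a (prepend k x (prepend j b z))) =
    eind (if strict then a < b else a <= b)%R * (\1_(E' a x) (prepend j (b - a) z))%:E.
  rewrite /g prepend_same prepend_other 1?eq_sym// prepend_other 1?eq_sym// prepend_same.
  case ab: (if strict then (a < b)%R else (a <= b)%R); last by rewrite !mul0e.
  have EE : ((prepend i a (prepend k x (prepend j b z)) : stream_space) \in E) =
      ((prepend j (b - a) z : stream_space) \in E' a x).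
    by apply/idP/idP; rewrite !inE => /(EE' _ _ _ _ ab).
  by rewrite !indicE EE.
pose Phi a := \int[Q]_z g (prepend i a z).
have Phi0 a : 0 <= Phi a by apply: integral_ge0 => z _.
have mPhi : measurable_fun setT Phi.
  apply: (@measurable_int_param _ _ _ _ _ Q (fun a (z : stream_space) => g (prepend i a z))) => //.
  exact: (measurableT_comp mg (measurable_prepend i)).
rewrite (integral_prepend QE i)//.
rewrite (integral_exponential (rate_gt0 i) (lawE i) mPhi Phi0).
apply: eq_intp => a a0.
suff -> : Phi a = (expR (- (rate j * a)))%:E * \int[law k]_x Q (E' a x).
  rewrite muleA -EFinM -mulrA -expRD.
  by congr ((_ * expR _)%:E * _); ring.
rewrite /Phi (integral_prepend QE k)// -ge0_integralZl//.
apply: eq_integral => x _.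
have mgk : measurable_fun setT (fun z : stream_space => g (prepend i a (prepend k x z))).
  exact: (measurableT_comp (mgi i a) (measurable_prepend2 k x)).
rewrite (integral_prepend QE j)//.
pose h b := \int[Q]_z (\1_(E' a x) (prepend j b z))%:E.
have mind : measurable_fun setT (fun w : R * stream_space =>
    (\1_(E' a x) (prepend j w.1 w.2))%:E : \bar R).
  apply/measurable_EFinP.
  exact: (measurableT_comp (measurable_indic (mE' a x)) (measurable_prepend j)).
have mh : measurable_fun setT h.
  apply: (@measurable_int_param _ _ _ _ _ Q (fun b (z : stream_space) =>
    (\1_(E' a x) (prepend j b z))%:E)); last exact: mind.
  by move=> b z; rewrite lee_fin.
have h0 b : 0 <= h b by apply: integral_ge0 => z _; rewrite lee_fin.
transitivity (\int[law j]_b (eind (if strict then a < b else a <= b)%R * h (b - a)%R)).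
  apply: eq_integral => b _; rewrite -ge0_integralZl ?eind_ge0//.
  - by apply: eq_integral => z _; rewrite gE.
  - exact: (measurableT_comp mind (pair1_measurable (b - a)%R)).
rewrite (integral_exponential_memoryless (rate_gt0 j) (lawE j) strict a0 mh h0).
congr (_ * _); rewrite /h -(integral_prepend QE j (g := fun z => (\1_(E' a x) z)%:E))//.
- by rewrite integral_indic// setIT.
- exact/measurable_EFinP.
Qed.
End first_jump.

(** * The equation for the escape probability *)

Definition row_tau1 : 'I_4 := @Ordinal 4 0 isT.
Definition row_tau2 : 'I_4 := @Ordinal 4 1 isT.
Definition row_xi1 : 'I_4 := @Ordinal 4 2 isT.
Definition row_xi2 : 'I_4 := @Ordinal 4 3 isT.

Section escape_probability.
Context {R : realType}.
Variables (c1 c2 r1 r2 : R).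
Variables (rate : 'I_4 -> R) (law : 'I_4 -> probability R R).
Variable Q : probability (@stream_space R) R.
Hypothesis rate_gt0 : forall s, 0 < rate s.
Hypothesis lawE : forall s B, measurable B -> law s B = exponential_prob (rate s) B.
Hypothesis QE : box_law law Q.

Definition stream_path (z : @streams R) (u v : R) : R -> R * R :=
  reflected c1 c2 r1 r2 (z row_tau1) (z row_tau2) (z row_xi1) (z row_xi2) u v.

Definition escape_event (u v : R) : set (@stream_space R) :=
  [set z | escapes (stream_path z u v)].

Definition good_streams : set (@stream_space R) :=
  [set z | non_explosive (z row_tau1)] `&` [set z | non_explosive (z row_tau2)].

(** The restart identity fails on exploding arrays, where the default value of
    the count takes over; excluding them is free and makes the identity hold
    without exception. *)
Definition good_escape u v := escape_event u v `&` good_streams.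

Lemma measurable_good : measurable good_streams.
Proof.
by apply: measurableI; exact: measurable_non_explosive.
Qed.

Lemma measurable_escape_event2 : measurable
  [set w : (R * R) * @stream_space R | escape_event w.1.1 w.1.2 w.2].
Proof.
have mrow s n : measurable_fun setT (fun w : (R * R) * @stream_space R => w.2 s n).
  exact: (measurableT_comp (measurable_coordinate s n) measurable_snd).
apply: measurable_escapes_reflected => //.
- exact: (measurable_pr1 measurable_fst).
- exact: (measurable_pr2 measurable_fst).
Qed.

Lemma measurable_escape_event u v : measurable (escape_event u v).
Proof.
have := measurable_xsection (u, v) measurable_escape_event2.
by congr measurable; apply/seteqP; split=> z; rewrite /xsection/= inE.
Qed.

Lemma measurable_good_escape u v : measurable (good_escape u v).
Proof. by apply: measurableI; [exact: measurable_escape_event|exact: measurable_good]. Qed.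

Lemma good_escapeE u v : Q (good_escape u v) = Q (escape_event u v).
Proof.
have mE := measurable_escape_event u v.
have bad0 : Q (escape_event u v `\` good_streams) = 0%E.
  have mbad s : measurable [set z : @stream_space R | ~ non_explosive (z s)].
    by apply: measurableC; exact: measurable_non_explosive.
  have bad s : Q.-negligible [set z : @stream_space R | ~ non_explosive (z s)].
    by apply/(negligibleP Q (mbad s)); exact: (non_explosive_ae rate_gt0 lawE QE).
  apply: (@measure_negligible _ _ _ Q).
    exact: measurableD measurable_good.
  apply: negligibleS (negligibleU (bad row_tau1) (bad row_tau2)).
  by move=> z [_ /not_andP]; exact.
rewrite [RHS](measureDI Q mE measurable_good) /=.
by rewrite [X in (X + _)%E]bad0 add0e.
Qed.

Definition escape_prob u v : R := fine (Q (escape_event u v)).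

Lemma escape_probE u v : (escape_prob u v)%:E = Q (good_escape u v).
Proof.
rewrite good_escapeE /escape_prob fineK// fin_num_measure//.
exact: measurable_escape_event.
Qed.

Lemma escape_prob01 u v : 0 <= escape_prob u v <= 1.
Proof.
rewrite /escape_prob fine_ge0//= -lee_fin fineK ?fin_num_measure//.
  by apply: probability_le1; exact: measurable_escape_event.
exact: measurable_escape_event.
Qed.

Lemma measurable_escape_prob : measurable_fun setT (fun w : R * R => escape_prob w.1 w.2).
Proof.
apply: (measurableT_comp (f := fine)
  (g := fun w : R * R => Q (escape_event w.1 w.2))) => //.
have := measurable_fun_xsection Q measurable_escape_event2.
congr measurable_fun; apply/funext => w /=; congr (Q _).
by apply/seteqP; split=> z; rewrite /xsection/= inE.
Qed.

Let prepend_scons (s : 'I_4) (a : R) z : prepend s a z s = scons a (z s).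
Proof. by apply/funext => n; rewrite prepend_same. Qed.

Lemma good_escape_jump1 u v a b x z : a <= b ->
  let y := reflect_jump r1 (u + c1 * a - x) (v + c2 * a) in
  good_escape u v (prepend row_tau1 a (prepend row_xi1 x (prepend row_tau2 b z))) <->
  good_escape y.1 y.2 (prepend row_tau2 (b - a) z).
Proof.
move=> ab y; rewrite /good_escape /escape_event /good_streams /stream_path /=.
rewrite !(prepend_scons, prepend_other)// !non_explosive_scons.
have H : non_explosive (z row_tau1) ->
    escapes (reflected c1 c2 r1 r2 (scons a (z row_tau1)) (scons b (z row_tau2))
      (scons x (z row_xi1)) (z row_xi2) u v) <->
    escapes (reflected c1 c2 r1 r2 (z row_tau1) (scons (b - a) (z row_tau2))
      (z row_xi1) (z row_xi2) y.1 y.2).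
  move=> ne1; apply: (@escapes_shift _ _ _ a) => t at_.
  exact: reflected_jump1.
by split=> -[h [n1 n2]]; (split; [exact/(H n1)|]).
Qed.

Lemma good_escape_jump2 u v a b x z : b < a ->
  let y := reflect_jump r2 (v + c2 * b - x) (u + c1 * b) in
  good_escape u v (prepend row_tau2 b (prepend row_xi2 x (prepend row_tau1 a z))) <->
  good_escape y.2 y.1 (prepend row_tau1 (a - b) z).
Proof.
move=> ba y; rewrite /good_escape /escape_event /good_streams /stream_path /=.
rewrite !(prepend_scons, prepend_other)// !non_explosive_scons.
have H : non_explosive (z row_tau2) ->
    escapes (reflected c1 c2 r1 r2 (scons a (z row_tau1)) (scons b (z row_tau2))
      (z row_xi1) (scons x (z row_xi2)) u v) <->
    escapes (reflected c1 c2 r1 r2 (scons (a - b) (z row_tau1)) (z row_tau2)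
      (z row_xi1) (z row_xi2) y.2 y.1).
  move=> ne2; apply: (@escapes_shift _ _ _ b) => t bt.
  exact: reflected_jump2.
by split=> -[h [n1 n2]]; (split; [exact/(H n2)|]).
Qed.

(** The two terms are the parts of the event on which the first, respectively
    the second component jumps first. The minimum of the two waiting times is
    exponential of rate the sum, which is the rate in both exponents. *)
Lemma escape_first_jump u v :
  (escape_prob u v)%:E =
  (\intp_a ((rate row_tau1 * expR (- ((rate row_tau1 + rate row_tau2) * a)))%:E *
     jump_mean (rate row_xi1) r1 escape_prob (u + c1 * a)%R (v + c2 * a)%R) +
   \intp_a ((rate row_tau2 * expR (- ((rate row_tau1 + rate row_tau2) * a)))%:E *
     jump_mean (rate row_xi2) r2 (fun y x => escape_prob x y) (v + c2 * a)%R (u + c1 * a)%R))%E.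
Proof.
have mG := measurable_good_escape u v.
have mi s := @measurable_coordinate R s 0.
have mlt b : measurable_fun setT (fun z : @stream_space R =>
    eind (if b then z row_tau2 0%N < z row_tau1 0%N
          else z row_tau1 0%N <= z row_tau2 0%N) : \bar R).
  by apply: measurable_eind; case: b;
    [exact: measurable_fun_ltr | exact: measurable_fun_ler].
have mind : measurable_fun setT (fun z => (\1_(good_escape u v) z)%:E : \bar R).
  exact/measurable_EFinP.
have mpf (f : R -> R * R) : measurable_fun setT f ->
    measurable_fun setT (fun x => (escape_prob (f x).1 (f x).2)%:E).
  move=> mf; apply/measurable_EFinP.
  apply: (measurable_comp2 measurable_escape_prob).
    exact: measurable_pr1.
  exact: measurable_pr2.
have part1 := first_jump_part rate_gt0 lawE QE (i := row_tau1) (j := row_tau2)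
  (k := row_xi1) (strict := false) (E := good_escape u v)
  (E' := fun a x => let y := reflect_jump r1 (u + c1 * a - x) (v + c2 * a) in
     good_escape y.1 y.2) isT isT isT mG.
have part2 := first_jump_part rate_gt0 lawE QE (i := row_tau2) (j := row_tau1)
  (k := row_xi2) (strict := true) (E := good_escape u v)
  (E' := fun b x => let y := reflect_jump r2 (v + c2 * b - x) (u + c1 * b) in
     good_escape y.2 y.1) isT isT isT mG.
have my1 a : measurable_fun setT (fun x : R =>
    reflect_jump r1 (u + c1 * a - x) (v + c2 * a)).
  by apply: measurable_reflect_jump; meas.
have my2 b : measurable_fun setT (fun x : R =>
    reflect_jump r2 (v + c2 * b - x) (u + c1 * b)).
  by apply: measurable_reflect_jump; meas.
have mp1 a := mpf _ (my1 a).
have mp2 b : measurable_fun setT (fun x : R =>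
    let y := reflect_jump r2 (v + c2 * b - x) (u + c1 * b) in (escape_prob y.2 y.1)%:E).
  by apply: (mpf (fun x => ((reflect_jump r2 (v + c2 * b - x) (u + c1 * b)).2,
    (reflect_jump r2 (v + c2 * b - x) (u + c1 * b)).1)));
  apply: measurable_fun_pair; [exact: measurable_pr2|exact: measurable_pr1].
rewrite escape_probE -[good_escape u v]setIT -integral_indic//.
transitivity (\int[Q]_z (eind (z row_tau1 0%N <= z row_tau2 0%N)%R *
      (\1_(good_escape u v) z)%:E) +
    \int[Q]_z (eind (z row_tau2 0%N < z row_tau1 0%N)%R *
      (\1_(good_escape u v) z)%:E))%E.
  rewrite -ge0_integralD//; last 4 first.
  - by move=> z _; rewrite mule_ge0 ?eind_ge0// lee_fin.
  - by apply: emeasurable_funM => //; exact: (mlt false).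
  - by move=> z _; rewrite mule_ge0 ?eind_ge0// lee_fin.
  - by apply: emeasurable_funM => //; exact: (mlt true).
  apply: eq_integral => z _.
  by case: leP => _; rewrite eindT eindF mul1e mul0e ?adde0 ?add0e.
rewrite part1; last 3 first.
- by move=> a x; exact: measurable_good_escape.
- by move=> a; under eq_fun do rewrite -escape_probE; exact: mp1.
- by move=> a b x z; exact: good_escape_jump1.
rewrite part2; last 3 first.
- by move=> a x; exact: measurable_good_escape.
- by move=> a; under eq_fun do rewrite -escape_probE; exact: mp2.
- by move=> a b x z; exact: good_escape_jump2.
apply: congr2; apply: eq_intp => a _.
  congr (_ * _)%E; rewrite /jump_mean.
  rewrite -(@integral_exponential _ _ (law row_xi1) (rate_gt0 _) (lawE _))//; last first.
    by move=> x; rewrite lee_fin; have /andP[] := escape_prob01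
      (reflect_jump r1 (u + c1 * a - x) (v + c2 * a)).1
      (reflect_jump r1 (u + c1 * a - x) (v + c2 * a)).2.
  by apply: eq_integral => x _; rewrite escape_probE.
rewrite [rate row_tau2 + _]addrC; congr (_ * _)%E; rewrite /jump_mean.
rewrite -(@integral_exponential _ _ (law row_xi2) (rate_gt0 _) (lawE _))//; last first.
  by move=> x; rewrite lee_fin; have /andP[] := escape_prob01
    (reflect_jump r2 (v + c2 * a - x) (u + c1 * a)).2
    (reflect_jump r2 (v + c2 * a - x) (u + c1 * a)).1.
by apply: eq_integral => x _; rewrite escape_probE.
Qed.
End escape_probability.

(** * The law of the driving data *)

Section joint_law.
Context {R : realType} d (T : measurableType d) (P : probability T R).
Variables (A B C D : nat -> {RV P >-> R}).
Variable rate : 'I_4 -> R.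
Hypothesis expX : forall s n, exponential_rv (rate s) (four_sequences A B C D (s, n)).
Hypothesis indep : mutually_independent (four_sequences A B C D).

Definition sample_streams (w : T) : @stream_space R :=
  fun s n => four_sequences A B C D (s, n) w.

Lemma measurable_sample_streams : measurable_fun setT sample_streams.
Proof. by apply: measurable_streams => s n; exact: measurable_funPT. Qed.

HB.instance Definition _ :=
  isMeasurableFun.Build _ _ _ _ sample_streams measurable_sample_streams.

Definition row_law (s : 'I_4) : probability R R :=
  distribution P (four_sequences A B C D (s, 0%N)).

Lemma row_lawE s E : measurable E -> row_law s E = exponential_prob (rate s) E.
Proof. exact: expX. Qed.

Lemma box_law_sample : box_law row_law (distribution P sample_streams).
Proof.
move=> N E mE EN.
pose J := [seq (s, n) | s <- enum 'I_4, n <- index_iota 0 N].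
rewrite /distribution /= /pushforward.
have -> : sample_streams @^-1` box E =
    \bigcap_(k in [set` J]) (four_sequences A B C D k @^-1` E k.1 k.2).
  apply/seteqP; split=> w /=; first by move=> h [s n] _; exact: h.
  move=> h s n; have [nN|Nn] := ltnP n N; last by rewrite EN.
  by apply: (h (s, n)); apply/allpairsP; exists (s, n); rewrite /= mem_enum mem_index_iota.
rewrite (indep (B := fun k => E k.1 k.2)); last 2 first.
- apply: allpairs_uniq; [exact: enum_uniq|exact: iota_uniq|].
  by move=> [s n] [s' n'] _ _ /= [-> ->].
- by move=> k _; exact: mE.
rewrite /J big_allpairs big_enum /=; apply: eq_bigr => s _.
rewrite big_mkord.
by apply: eq_bigr => n _; rewrite row_lawE ?expX.
Qed.
End joint_law.

Theorem proposition8 (R : realType) (d : measure_display) (T : measurableType d)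
    (P : probability T R)
    (c1 c2 lam1 lam2 q1 q2 r1 r2 : R)
    (tau1 tau2 xi1 xi2 : nat -> {RV P >-> R})
    (c1_gt0 : 0 < c1) (c2_gt0 : 0 < c2)
    (lam1_gt0 : 0 < lam1) (lam2_gt0 : 0 < lam2)
    (q1_gt0 : 0 < q1) (q2_gt0 : 0 < q2)
    (r1_gt0 : 0 < r1) (r2_gt0 : 0 < r2)
    (tau1_exp : forall k, exponential_rv lam1 (tau1 k))
    (tau2_exp : forall k, exponential_rv lam2 (tau2 k))
    (xi1_exp : forall k, exponential_rv q1 (xi1 k))
    (xi2_exp : forall k, exponential_rv q2 (xi2 k))
    (indep : mutually_independent (four_sequences tau1 tau2 xi1 xi2))
    (mu1_lt0 : drift c1 lam1 q1 < 0) (mu2_lt0 : drift c2 lam2 q2 < 0)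
    (r1_large : `|drift c2 lam2 q2| < r1 * `|drift c1 lam1 q1|)
    (r2_large : `|drift c1 lam1 q1| < r2 * `|drift c2 lam2 q2|) :
  let p1 := escape1 c1 c2 r1 r2 tau1 tau2 xi1 xi2 in
  let F := laplace2 p1 in
  let F1 := laplace (fun u => p1 u 0) in
  let F2 := laplace (fun v => p1 0 v) in
  let F0 := c2 * F1 (q2 / r2) + c1 * F2 (q1 / r1) in
  let psi := laplace_exponent c1 c2 lam1 lam2 q1 q2 in
  let psi1 := kernel1 c2 lam2 q2 r2 in
  let psi2 := kernel2 c1 lam1 q1 r1 in
  let G1 s2 := fun s1 => psi1 s1 s2 * (F1 s1 - F1 (q2 / r2)) in
  let G2 s1 := fun s2 => psi2 s1 s2 * (F2 s2 - F2 (q1 / r1)) in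
  forall s1 s2 : R, 0 < s1 -> 0 < s2 ->
  [/\ cvg (G1 s2 x @[x --> (q2 / r2)^']),
      cvg (G2 s1 x @[x --> (q1 / r1)^']) &
      psi s1 s2 * F s1 s2 =
        by_continuity (q2 / r2) (G1 s2) s1
        + by_continuity (q1 / r1) (G2 s1) s2 + F0].
Proof.
pose rate (s : 'I_4) : R := nth lam1 [:: lam1; lam2; q1; q2] s.
have rate_gt0 s : 0 < rate s.
  by case: s => -[|[|[|[|//]]]] /=.
have expX s n : exponential_rv (rate s) (four_sequences tau1 tau2 xi1 xi2 (s, n)).
  by case: s => -[|[|[|[|//]]]] ? /=; [exact: tau1_exp|exact: tau2_exp
    |exact: xi1_exp|exact: xi2_exp].
pose Z := sample_streams tau1 tau2 xi1 xi2.
pose Q : probability (@stream_space R) R := distribution P Z.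
have QE := box_law_sample expX indep.
have lawE s B := @row_lawE _ _ _ _ _ _ _ _ _ expX s B.
(* [p1 u v] is [escape_prob] for [Q], the pushforward of [P], by conversion. *)
move=> p1 F F1 F2 F0 psi psi1 psi2 G1 G2 s1 s2 s1_gt0 s2_gt0.
exact: (@kernel_equation R c1 c2 lam1 lam2 q1 q2 r1 r2 c1_gt0 c2_gt0 lam1_gt0 lam2_gt0
  q1_gt0 q2_gt0 r1_gt0 r2_gt0
  (escape_prob c1 c2 r1 r2 Q)
  (measurable_escape_prob c1 c2 r1 r2 Q) (escape_prob01 c1 c2 r1 r2 Q)
  (fun u v _ _ => escape_first_jump c1 c2 r1 r2 rate_gt0 lawE QE u v)
  s1 s2 s1_gt0 s2_gt0).
Qed.
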